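(* Let $K(\alpha)$, $\alpha\in I$, be a $\mathcal{C}^{r,r'}$ billiard deformation with $r\ge2$, $r'\ge1$. For any $n$, any $\xi\in\Sigma_n$ and any $j$, the derivatives of the parameters satisfy $$\left|\frac{\partial u_j}{\partial\alpha}\right|\le\frac{1}{\cos\phi_j}\,\frac{C^{(0,1)}_\varphi+C^{(1,1)}_\varphi d_{\min}}{\kappa_{\min}d_{\min}}.$$
   Context: Deformations. A function $f(x,y)$ is $\mathcal{C}^{A,B}$ if $\partial^{a+b}f/\partial x^a\partial y^b$ is continuous for all $a\le A$, $b\le B$. Let $m\ge3$ and let $I\subseteq[-\infty,\infty]$ be a closed interval. $K(\alpha)=\bigcup_{i=1}^m K_i(\alpha)\subset\mathbb{R}^2$, $\alpha\in I$, is a $\mathcal{C}^{r,r'}$ billiard deformation if for each $\alpha$: the $K_i(\alpha)$ are pairwise disjoint, compact, strictly convex (boundary curvature everywhere positive) with $\mathcal{C}^r$ boundary of length $L_i(\alpha)$; the no-eclipse condition holds (for distinct $i,j,k$ the convex hull of $K_i(\alpha)\cup K_j(\alpha)$ is disjoint from $K_k(\alpha)$); $\partial K_i(\alpha)$ is parametrized counterclockwise by arclength by a $\mathcal{C}^{r,r'}$ function $\tilde\varphi_i(\tilde u,\alpha)$, $\tilde u\in[0,L_i(\alpha)]$; and for all $0\le q\le r$, $0\le q'\le r'$, $(q,q')\ne(0,0)$, there are constants $C^{(q,q')}_\varphi$ (depending on $\alpha$) with $\left\|\partial^{q+q'}\tilde\varphi_i/\partial\tilde u^q\partial\alpha^{q'}\right\|\le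 C^{(q,q')}_\varphi$ for all $i$. Only one of the obstacles depends on $\alpha$. The parametrizations are extended $L_i(\alpha)$-periodically in $\tilde u$; the derivative of a parameter $u_j$ at $\alpha_0$ is that of the continuous local branch whose value at $\alpha_0$ lies in $[0,L_{\xi_j}(\alpha_0)]$. Periodic points. $\Sigma_n$ is the set of $\xi=(\xi_0,\dots,\xi_{n-1})$ with $\xi_i\in\{1,\dots,m\}$, $\xi_i\ne\xi_{i+1}$, $\xi_{n-1}\ne\xi_0$; indices are mod $n$ and $\varphi_j=\tilde\varphi_{\xi_j}$. For $\xi\in\Sigma_n$ and $\alpha\in I$, the length function $G_\xi(u,\alpha)=\sum_{j=1}^n\|\varphi_j(u_j,\alpha)-\varphi_{j-1}(u_{j-1},\alpha)\|$ has exactly one minimizer $u(\alpha)=(u_0(\alpha),\dots,u_{n-1}(\alpha))$; the points $p_j=\varphi_j(u_j(\alpha),\alpha)$ are the successive reflection points of the periodic billiard trajectory with itinerary $\xi$. $\phi_j\in[0,\pi/2)$ is the angle at $p_j$ between the outgoing velocity (direction of $p_{j+1}-p_j$) and the outward unit normal of $K_{\xi_j}(\alpha)$. Constants. Let $M_0(\alpha)$ be the set of $(q,v)$, $q\in\partial K(\alpha)$, $v$ a unit (post-reflection) velocity, whose billiard trajectory in the exterior of $K(\alpha)$ (with elastic reflections) has infinitely many reflections forward and backward in time. $d_{\min}$ is the minimum over $M_0(\alpha)$ of the distance from $q$ to the next reflection point; $\kappa_{\min}>0$ is the minimum over $M_0(\alpha)$ of the curvature of $\partial K(\alpha)$ at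 $q$. *)

(* Defs.v *)
From HB Require Import structures.
From mathcomp Require Import all_boot all_order all_algebra.
From mathcomp Require Import all_classical all_reals all_analysis.
Import Order.TTheory GRing.Theory Num.Theory.
Import numFieldNormedType.Exports.

Set Implicit Arguments.
Unset Strict Implicit.
Unset Printing Implicit Defensive.

Local Open Scope classical_set_scope.
Local Open Scope ring_scope.

(* The library norm of R * R is the sup norm (same topology); all lengths and
   distances below are Euclidean. *)
Notation plane R := (R * R)%type.

Section Plane.
Context {R : realType}.
Local Notation plane := (plane R).

Definition dot (x y : plane) : R := x.1 * y.1 + x.2 * y.2.
Definition cross (x y : plane) : R := x.1 * y.2 - x.2 * y.1.
Definition enorm (x : plane) : R := Num.sqrt (dot x x).
Definition angle (x y : plane) : R := acos (dot x y / (enorm x * enorm y)).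

Definition boundary (A : set plane) : set plane := closure A `\` A°.

Definition strictly_convex (A : set plane) : Prop :=
  forall (x y : plane) (t : R), A x -> A y -> x != y -> 0 < t < 1 ->
    A° ((1 - t) *: x + t *: y).

Definition convex_hull (A : set plane) : set plane :=
  [set x | forall B : set (convex_lmodType plane),
             convex_set B -> A `<=` B -> B x].

End Plane.

Section Smoothness.
Context {R : realType}.

Definition is_derive_within (V : normedModType R) (Y : set R) (f : R -> V)
    (x : R) (l : V) : Prop :=
  (y - x)^-1 *: (f y - f x) @[y --> within Y x^'] --> l.

Definition class_C (r : nat) (f : R -> plane R) : Prop :=
  (forall q, (q < r)%N -> forall x, derivable (derive1n q f) x 1) /\
  (forall q, (q <= r)%N -> continuous (derive1n q f)).

(* [D a b] is the derivative of order a in the first variable of the derivative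
   of order b in the second variable of [D 0 0], on R x Y; so [D 0 0] is of
   class C^{A,B} there.  Derivatives in the second variable are taken within Y,
   hence are one-sided at an end point of an interval Y. *)
Definition mixed_partials (Y : set R) (A B : nat)
    (D : nat -> nat -> R -> R -> plane R) : Prop :=
  [/\ forall a b u y, (a < A)%N -> (b <= B)%N -> Y y ->
        is_derive (u : R) 1 (D a b ^~ y) (D a.+1 b u y),
      forall b u y, (b < B)%N -> Y y ->
        is_derive_within Y (D 0%N b u) y (D 0%N b.+1 u y) &
      forall a b, (a <= A)%N -> (b <= B)%N ->
        {within [set p : R * R | Y p.2],
           continuous (fun p => D a b p.1 p.2)}].

End Smoothness.

(* m obstacles; [param i] is the periodic extension to R of the
   parametrization of the boundary of [body i] by [0, perim i]. *)
Record table (R : realType) (m : nat) := Table {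
  body : 'I_m -> set (plane R);
  perim : 'I_m -> R;
  param : 'I_m -> R -> plane R }.

Section Table.
Context {R : realType} {m : nat}.
Variable T : table R m.

Definition tangent (i : 'I_m) (u : R) : plane R := derive1 (param T i) u.

(* Outward because the parametrization is counterclockwise by arclength. *)
Definition normal (i : 'I_m) (u : R) : plane R :=
  ((tangent i u).2, - (tangent i u).1).

(* Signed curvature of a curve parametrized by arclength. *)
Definition curvature (i : 'I_m) (u : R) : R :=
  cross (tangent i u) (derive1n 2 (param T i) u).

Record billiard_table (r : nat) : Prop := BilliardTable {
  body_disjoint : forall i j, i != j -> body T i `&` body T j = set0;
  body_compact : forall i, compact (body T i);
  body_strictly_convex : forall i, strictly_convex (body T i);
  perim_gt0 : forall i, 0 < perim T i;
  param_periodic : forall i u, param T i (u + perim T i) = param T i u;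
  param_boundary : forall i,
    param T i @` [set u | 0 <= u <= perim T i] = boundary (body T i);
  param_inj : forall i u v, 0 <= u < perim T i -> 0 <= v < perim T i ->
    param T i u = param T i v -> u = v;
  param_class_C : forall i, class_C r (param T i);
  param_arclength : forall i u, enorm (tangent i u) = 1;
  (* counterclockwise: the obstacle lies to the left of the tangent *)
  param_ccw : forall i u x, (body T i)° x ->
    0 < cross (tangent i u) (x - param T i u);
  curvature_gt0 : forall i u, 0 < curvature i u;
  no_eclipse : forall i j k, i != j -> j != k -> i != k ->
    convex_hull (body T i `|` body T j) `&` body T k = set0 }.

Definition obstacles : set (plane R) := \bigcup_i body T i.

Definition next_reflection (q v q' : plane R) : Prop :=
  obstacles q' /\
  exists t : R, [/\ 0 < t, q' = q + t *: v &
    forall s, 0 < s < t -> ~ obstacles (q + s *: v)].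

(* Bi-infinite sequence of reflections: the k-th one takes place at
   [param T (i k) (u k)], where the velocity becomes [v k]. *)
Definition trajectory (i : int -> 'I_m) (u : int -> R) (v : int -> plane R) :
    Prop :=
  forall k : int,
    [/\ enorm (v k) = 1,
        next_reflection (param T (i k) (u k)) (v k)
          (param T (i (k + 1)) (u (k + 1))) &
        v (k + 1) = let nu := normal (i (k + 1)) (u (k + 1)) in
                    v k - (2 * dot (v k) nu) *: nu].

Definition M0 : set (plane R * plane R) :=
  [set x | exists i u v, [/\ trajectory i u v,
             x.1 = param T (i 0) (u 0) & x.2 = v 0]].

(* M0 is compact, so these infima are minima. *)
Definition d_min : R :=
  inf [set d | exists q v q',
         [/\ M0 (q, v), next_reflection q v q' & d = enorm (q' - q)]].
Definition kappa_min : R :=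
  inf [set k | exists i u v, M0 (param T i u, v) /\ k = curvature i u].

Section Periodic.
Variables (n : nat) (xi : 'I_n -> 'I_m).

(* Indices are mod n: [ordS] and [ord_pred] are cyclic. *)
Definition admissible : Prop := forall j, xi j != xi (ordS j).

Definition length_fun (w : 'I_n -> R) : R :=
  \sum_(j < n) enorm (param T (xi j) (w j)
                      - param T (xi (ord_pred j)) (w (ord_pred j))).

Definition minimizer (w : 'I_n -> R) : Prop :=
  forall w', length_fun w <= length_fun w'.

Definition reflection_angle (w : 'I_n -> R) (j : 'I_n) : R :=
  angle (param T (xi (ordS j)) (w (ordS j)) - param T (xi j) (w j))
        (normal (xi j) (w j)).

End Periodic.
End Table.

Section Deformation.
Context {R : realType} {m : nat}.

(* The finite parameters of a closed interval [a, b] of the extended line. *)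
Definition param_itv (a b : \bar R) : set R :=
  [set x | (a <= x%:E)%E && (x%:E <= b)%E].

Variables (Y : set R) (K : R -> table R m).

(* Joint regularity is only required on the strip {0 <= u <= perim}, as the
   restriction of a C^{r,r'} function on R x Y: as the perimeter varies, the
   periodic extension need not be C^{r,r'} across the seam. *)
Record billiard_deformation (r r' : nat) (C : nat -> nat -> R -> R) : Prop :=
  BilliardDeformation {
  deformation_table : forall y, Y y -> billiard_table (K y) r;
  deformation_smooth : forall i, exists D,
    [/\ mixed_partials Y r r' D,
        forall u y, Y y -> 0 <= u <= perim (K y) i ->
          param (K y) i u = D 0%N 0%N u y &
        forall q q' u y, (q <= r)%N -> (q' <= r')%N ->
          (q, q') != (0%N, 0%N) -> Y y -> 0 <= u <= perim (K y) i ->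
          enorm (D q q' u y) <= C q q' y];
  deformation_single : exists i0, forall i, i != i0 ->
    forall y z, Y y -> Y z ->
      [/\ body (K y) i = body (K z) i, perim (K y) i = perim (K z) i &
          param (K y) i = param (K z) i] }.

(* Continuous local branch at y0 of the parameters of the periodic orbit with
   itinerary xi, with values at y0 in the fundamental periods. *)
Definition local_branch (n : nat) (xi : 'I_n -> 'I_m) (y0 : R)
    (u : R -> 'I_n -> R) : Prop :=
  (\forall y \near within Y (nbhs y0), minimizer (K y) xi (u y) /\
     forall k, u z k @[z --> within Y (nbhs y)] --> u y k) /\
  forall k, 0 <= u y0 k <= perim (K y0) (xi k).

End Deformation.

(* Main.v *)
Require Import Defs.
From mathcomp Require Import all_boot all_order all_algebra.
From mathcomp Require Import ring lra zify.
From mathcomp Require Import all_classical all_reals all_analysis.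
Import Order.TTheory GRing.Theory Num.Theory.
Import numFieldNormedType.Exports.
Set Implicit Arguments.
Unset Strict Implicit.
Unset Printing Implicit Defensive.
Local Open Scope classical_set_scope.
Local Open Scope ring_scope.

(* Write v_j for the unit velocity leaving p_j, c_j = cos phi_j, k_j for the
   curvature at p_j and d_j = |p_(j+1) - p_j|.  A minimizer of the length is a
   critical point, and by convexity and the no-eclipse condition it is a genuine
   billiard orbit; in particular c_j > 0, d_min <= d_j and kappa_min <= k_j.
   Differentiating the critical point equations in alpha and dividing the j-th
   one by c_j gives, for x_j = c_j u_j',
     2 k_j x_j / c_j + (x_j + x_(j-1)) / d_(j-1) + (x_j + x_(j+1)) / d_j = E_j
   with |E_j| <= 2 (C11 + C01 / d_min), because two consecutive obstacles do not
   both move.  Where |x_j| is maximal the two quotients have the sign of x_j, so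
   kappa_min |x_j| <= C11 + C01 / d_min.  The same argument shows that the
   linearized system is injective, which yields the existence of u_j'.

   The parametrizations are smooth in alpha only over one period, so when p_j
   sits at the end of a period the perimeter has to be controlled: it is
   continuous, by strict convexity, and then Lipschitz at alpha, which suffices
   for first order expansions of the periodic extensions. *)

(** * Plane vectors *)

(** Stationarity of the length only equates tangential components of velocity. It also allows
    passing straight through an obstacle, and reflecting from its inner side; the first is excluded
    by the no-eclipse condition, the second only by comparing lengths with another boundary point,
    which is where global minimality enters. The substitution x_j = c_j u_j' is dictated by the
    Hessian of the length: a flight of length d between p_j and p_k contributes c_j^2 / d on the
    diagonal and c_j c_k / d off it. After division of row j by c_j both become 1 / d in front of
    x_j and x_k, so that each flight enters through x_j + x_k alone. The implicit function theorem
    is out of reach, since across the seam the gradient of the length need not be C^1 in alpha. Only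
    expansions at the base point are available. As u is known to be continuous, they suffice: the
    gradient vanishes along the branch, which is an exact linear system for the increments with
    convergent coefficients, and the quotients converge once the limit system is injective. *)

Section PlaneAlgebra.
Context {R : realType}.
Implicit Types x y z : plane R.

Lemma dotC x y : dot x y = dot y x.
Proof. by rewrite /dot mulrC [x.2 * _]mulrC. Qed.

Lemma dotDl x y z : dot (x + y) z = dot x z + dot y z.
Proof. rewrite /dot /=; ring. Qed.

Lemma dotNl x z : dot (- x) z = - dot x z.
Proof. rewrite /dot /=; ring. Qed.

Lemma dotBl x y z : dot (x - y) z = dot x z - dot y z.
Proof. by rewrite dotDl dotNl. Qed.

Lemma dotDr x y z : dot z (x + y) = dot z x + dot z y.
Proof. by rewrite dotC dotDl !(dotC _ z). Qed.

Lemma dotBr x y z : dot z (x - y) = dot z x - dot z y.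
Proof. by rewrite dotC dotBl !(dotC _ z). Qed.

Lemma dotZl (t : R) x z : dot (t *: x) z = t * dot x z.
Proof. rewrite /dot /= /GRing.scale /=; ring. Qed.

Lemma dotZr (t : R) x z : dot z (t *: x) = t * dot z x.
Proof. by rewrite dotC dotZl dotC. Qed.

Lemma crossC x y : cross x y = - cross y x.
Proof. rewrite /cross; ring. Qed.

Lemma crossDr x y z : cross z (x + y) = cross z x + cross z y.
Proof. rewrite /cross /=; ring. Qed.

Lemma crossNr x z : cross z (- x) = - cross z x.
Proof. rewrite /cross /=; ring. Qed.

Lemma crossNl x z : cross (- x) z = - cross x z.
Proof. by rewrite /cross /=; ring. Qed.

Lemma crossBr x y z : cross z (x - y) = cross z x - cross z y.
Proof. by rewrite crossDr crossNr. Qed.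

Lemma crossZr (t : R) x z : cross z (t *: x) = t * cross z x.
Proof. rewrite /cross /= /GRing.scale /=; ring. Qed.

Lemma crossxx x : cross x x = 0.
Proof. rewrite /cross; ring. Qed.

Lemma crossr0 x : cross x 0 = 0.
Proof. by rewrite /cross /= !mulr0 subrr. Qed.

Lemma dot_ge0 x : 0 <= dot x x.
Proof. by rewrite /dot -!expr2 addr_ge0 ?sqr_ge0. Qed.

Lemma enorm_ge0 x : 0 <= enorm x.
Proof. exact: sqrtr_ge0. Qed.

Lemma sqr_enorm x : enorm x ^+ 2 = dot x x.
Proof. by rewrite sqr_sqrtr // dot_ge0. Qed.

Lemma enorm_gt0 x : (0 < enorm x) = (x != 0).
Proof.
rewrite /enorm sqrtr_gt0 lt_neqAle dot_ge0 andbT eq_sym; congr negb.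
rewrite /dot -!expr2 paddr_eq0 ?sqr_ge0 // !sqrf_eq0.
by case: x.
Qed.

Lemma enormN x : enorm (- x) = enorm x.
Proof. by rewrite /enorm; congr Num.sqrt; rewrite /dot /=; ring. Qed.

Lemma enormB x y : enorm (x - y) = enorm (y - x).
Proof. by rewrite -enormN opprB. Qed.

Lemma dot_cross_sqr x y : dot x y ^+ 2 + cross x y ^+ 2 = (enorm x * enorm y) ^+ 2.
Proof. rewrite exprMn !sqr_enorm /dot /cross; ring. Qed.

Lemma dot_le x y : `|dot x y| <= enorm x * enorm y.
Proof.
rewrite -[leRHS]ger0_norm ?mulr_ge0 ?enorm_ge0 // -ler_sqr ?nnegrE ?normr_ge0 //.
by rewrite !real_normK ?num_real // -dot_cross_sqr lerDl sqr_ge0.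
Qed.

Lemma cross_le x y : `|cross x y| <= enorm x * enorm y.
Proof.
rewrite -[leRHS]ger0_norm ?mulr_ge0 ?enorm_ge0 // -ler_sqr ?nnegrE ?normr_ge0 //.
by rewrite !real_normK ?num_real // -dot_cross_sqr lerDr sqr_ge0.
Qed.

Lemma enormZ (t : R) x : enorm (t *: x) = `|t| * enorm x.
Proof.
by rewrite /enorm dotZl dotZr mulrA -expr2 sqrtrM ?sqr_ge0 // sqrtr_sqr.
Qed.

Lemma enormD_lt x y :
  dot x y < enorm x * enorm y -> enorm (x + y) < enorm x + enorm y.
Proof.
move=> h; rewrite -ltr_sqr ?nnegrE ?addr_ge0 ?enorm_ge0 //.
rewrite sqrrD !sqr_enorm dotDl !dotDr (dotC y x); lra.
Qed.

Lemma unit_dot_lt1 x y : enorm x = 1 -> enorm y = 1 -> x != y -> dot x y < 1.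
Proof.
move=> hx hy; rewrite -subr_eq0 -enorm_gt0 => h.
have : 0 < dot (x - y) (x - y) by rewrite -sqr_enorm exprn_gt0.
rewrite dotBl !dotBr -!sqr_enorm hx hy (dotC y x); lra.
Qed.

Lemma unit_cross0 x y : enorm x = 1 -> enorm y = 1 -> cross x y = 0 ->
  0 < dot x y -> x = y.
Proof.
move=> hx hy hc hd; apply/eqP; case: (boolP (x == y)) => // ne.
have h1 := unit_dot_lt1 hx hy ne; have := dot_cross_sqr x y; rewrite hc hx hy.
move=> h; exfalso; nra.
Qed.

End PlaneAlgebra.

(** * Derivatives of plane curves, and periodic functions *)

Section Curves.
Context {R : realType}.
Implicit Types (f : R -> plane R) (x : R) (l z : plane R).

Lemma is_derive1_cvg (V : normedModType R) (f : R -> V) x (l : V) :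
  is_derive x 1 f l <-> h^-1 *: (f (h + x) - f x) @[h --> 0^'] --> l.
Proof.
have E : (fun h : R => h^-1 *: ((f \o shift x) (h *: 1) - f x)) =
         (fun h : R => h^-1 *: (f (h + x) - f x)).
  by apply/funext => h /=; rewrite /shift /= /GRing.scale /= mulr1.
split=> [[d <-]|h].
  by rewrite /derive E; move: d; rewrite /derivable E.
have d : derivable f x 1 by rewrite /derivable E; apply/cvg_ex; exists l.
by split=> //; rewrite /derive E; apply/cvg_lim.
Qed.

Lemma is_derive_unique (V : normedModType R) (f : R -> V) x (a b : V) :
  is_derive x 1 f a -> is_derive x 1 f b -> a = b.
Proof. by move=> [_ <-] [_ <-]. Qed.

Lemma is_derive_fst f x l : is_derive x 1 f l -> is_derive x 1 (fun t => (f t).1) l.1.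
Proof.
move=> /is_derive1_cvg h; apply/is_derive1_cvg.
exact: (cvg_comp _ _ h (@cvg_fst _ _ (nbhs l.1) (nbhs l.2) _)).
Qed.

Lemma is_derive_snd f x l : is_derive x 1 f l -> is_derive x 1 (fun t => (f t).2) l.2.
Proof.
move=> /is_derive1_cvg h; apply/is_derive1_cvg.
exact: (cvg_comp _ _ h (@cvg_snd _ _ (nbhs l.1) (nbhs l.2) _)).
Qed.

Lemma is_derive_dot f g x l z : is_derive x 1 f l -> is_derive x 1 g z ->
  is_derive x 1 (fun t => dot (f t) (g t)) (dot l (g x) + dot (f x) z).
Proof.
move=> hf hg.
have f1 := is_derive_fst hf; have f2 := is_derive_snd hf.
have g1 := is_derive_fst hg; have g2 := is_derive_snd hg.
rewrite /dot; apply: is_derive_eq; rewrite /GRing.scale /=; ring.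
Qed.

Lemma is_derive_dotl f x l z : is_derive x 1 f l ->
  is_derive x 1 (fun t => dot (f t) z) (dot l z).
Proof.
move=> hf; have := is_derive_dot hf (is_derive_cst z x 1).
suff -> : dot (f x) 0 = 0 by rewrite addr0.
by rewrite /dot /= !mulr0 addr0.
Qed.

Lemma is_derive_crossr f x l z : is_derive x 1 f l ->
  is_derive x 1 (fun t => cross z (f t)) (cross z l).
Proof.
move=> hf; have := is_derive_dotl (- z.2, z.1) hf; rewrite /dot /cross /=.
have -> : l.1 * - z.2 + l.2 * z.1 = z.1 * l.2 - z.2 * l.1 by ring.
by congr is_derive; apply/funext => t; ring.
Qed.

Lemma is_derive_enormB f x l z : f x != z -> is_derive x 1 f l ->
  is_derive x 1 (fun t => enorm (f t - z)) (dot l (f x - z) / enorm (f x - z)).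
Proof.
move=> ne hf; have ne0 : 0 < enorm (f x - z) by rewrite enorm_gt0 subr_eq0.
have hb : is_derive x 1 (fun t => f t - z) (l - 0).
  exact: (is_deriveB hf (is_derive_cst z x 1)).
have hd := is_derive_dot hb hb; rewrite subr0 in hd.
have p : 0 < dot (f x - z) (f x - z) by rewrite -sqr_enorm exprn_gt0.
have hs := @is_derive1_sqrt R _ p.
have := @is_derive1_comp R Num.sqrt (fun t => dot (f t - z) (f t - z)) x _ _ hs hd.
rewrite /enorm in ne0 *; congr is_derive.
rewrite (dotC (f x - z) l) -mulr2n invrM ?unitfE ?gt_eqF ?mulf_eq0 //.
by field; rewrite gt_eqF.
Qed.

Lemma derive1_periodic f (L : R) :
  (forall u, f (u + L) = f u) -> forall u, derive1 f (u + L) = derive1 f u.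
Proof.
move=> h u; rewrite /derive1; 
suff -> : (fun t : R => t^-1 *: (f (t + (u + L)) - f (u + L))) =
          (fun t => t^-1 *: (f (t + u) - f u)) by [].
by apply/funext => t; rewrite addrA !h.
Qed.

Lemma is_derive_continuous (V : normedModType R) (f : R -> V) x (l : V) :
  is_derive x 1 f l -> {for x, continuous f}.
Proof. by move=> [d _]; apply: differentiable_continuous; apply/derivable1_diffP. Qed.

Lemma periodicz (V : Type) (f : R -> V) (L : R) : (forall u, f (u + L) = f u) ->
  forall (k : int) u, f (u + k%:~R * L) = f u.
Proof.
move=> h k; have hn (n : nat) u : f (u + n%:R * L) = f u.
  elim: n u => [|n IH] u; first by rewrite mul0r addr0.
  by rewrite -natr1 mulrDl mul1r addrA h IH.
case: k => n u; first exact: hn.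
by rewrite NegzE -[in RHS](subrK (n.+1%:R * L) u) hn mulrNz mulNr.
Qed.

Lemma fundamental_period (L u : R) : 0 < L ->
  exists k : int, 0 <= u + k%:~R * L < L.
Proof.
move=> L0; exists (- Num.floor (u / L)).
have := floor_le (u / L); rewrite ler_pdivlMr // => h1.
have := floorD1_gt (u / L); rewrite ltr_pdivrMr // intrD mulrDl mul1r => h2.
by rewrite mulrNz mulNr; apply/andP; split; lra.
Qed.

End Curves.

(** * Billiard tables *)

Section TableGeometry.
Context {R : realType} {m r : nat} (T : table R m).
Hypotheses (hr : (2 <= r)%N) (hT : billiard_table T r).
Implicit Types (i : 'I_m) (u t : R) (x y : plane R).

Notation tangent2 i u := (derive1n 2 (param T i) u).

Lemma is_derive_param i u : is_derive u 1 (param T i) (tangent T i u).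
Proof.
have [h _] := param_class_C hT i.
have := h 0%N (leq_trans (isT : (0 < 2)%N) hr) u.
by rewrite derive1n0 /tangent derive1E => /derivableP.
Qed.

Lemma is_derive_tangent i u : is_derive u 1 (tangent T i) (tangent2 i u).
Proof.
have [h _] := param_class_C hT i.
have := h 1%N hr u; rewrite (derive1nS _ 1) derive1n1 derive1E => /derivableP.
by [].
Qed.

Lemma tangent2_continuous i : continuous (derive1n 2 (param T i)).
Proof. by have [_ h] := param_class_C hT i; exact: (h 2%N hr). Qed.

Lemma tangent_periodic i u : tangent T i (u + perim T i) = tangent T i u.
Proof. exact/derive1_periodic/(param_periodic hT). Qed.

Lemma tangent2_periodic i u : tangent2 i (u + perim T i) = tangent2 i u.
Proof.
rewrite (derive1nS _ 1) derive1n1; exact/derive1_periodic/tangent_periodic.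
Qed.

Lemma param_body i u : body T i (param T i u).
Proof.
have cl : closed (body T i).
  refine (compact_closed (@norm_hausdorff _ _) _); exact: (body_compact hT).
have [k hk] := fundamental_period u (perim_gt0 hT i).
have [k1 k2] := andP hk.
rewrite -(periodicz (param_periodic hT i) k) (closure_id (body T i)).1 //.
have : boundary (body T i) (param T i (u + k%:~R * perim T i)).
  rewrite -(param_boundary hT i); exists (u + k%:~R * perim T i) => //=.
  by rewrite k1 ltW.
by case.
Qed.

(* The midpoint of a chord is an interior point. *)
Lemma chord_left i u x : body T i x -> x != param T i u ->
  0 < cross (tangent T i u) (x - param T i u).
Proof.
move=> hx ne.
have h2 : 0 < (2^-1 : R) < 1 by rewrite invr_gt0 invf_lt1 ?ltr1n ltr0n.
have := body_strictly_convex hT (param_body i u) hx _ h2.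
rewrite eq_sym => /(_ ne) hI.
have := param_ccw hT u hI.
have -> : (1 - 2^-1) *: param T i u + 2^-1 *: x - param T i u =
          2^-1 *: (x - param T i u).
  by apply: injective_projections => /=; rewrite /GRing.scale /=; field.
by rewrite crossZr pmulr_rgt0 // invr_gt0 ltr0n.
Qed.

Lemma param_neq i j u t : i != j -> param T i u != param T j t.
Proof.
move=> ne; apply/eqP => e.
have : (body T i `&` body T j) (param T i u).
  by split; [exact: param_body|rewrite e; exact: param_body].
by rewrite (body_disjoint hT ne).
Qed.

Lemma not_in_other i j u : i != j -> ~ body T j (param T i u).
Proof.
move=> ne h; have : (body T i `&` body T j) (param T i u).
  by split=> //; exact: param_body.
by rewrite (body_disjoint hT ne).
Qed.

Lemma segment_body i x y t : body T i x -> body T i y -> 0 <= t <= 1 ->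
  body T i (x + t *: (y - x)).
Proof.
move=> hx hy /andP[t0 t1].
have [->|ne] := eqVneq x y; first by rewrite subrr scaler0 addr0.
move: t0; rewrite le_eqVlt => /orP[/eqP <-|t0]; first by rewrite scale0r addr0.
move: t1; rewrite le_eqVlt => /orP[/eqP ->|t1].
  by rewrite scale1r addrC subrK.
have := body_strictly_convex hT hx hy ne; move=> /(_ t).
rewrite t0 t1 => /(_ isT) /interior_subset; congr (body T i _).
by apply: injective_projections => /=; rewrite /GRing.scale /=; ring.
Qed.

(** The case i = k must be covered because an itinerary may return at once to the obstacle it left;
    there convexity and disjointness replace the no-eclipse condition. *)
Lemma segment_no_eclipse i j k u t s :
  i != j -> j != k -> 0 <= s <= 1 ->
  ~ body T j (param T i u + s *: (param T k t - param T i u)).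
Proof.
move=> ij jk hs; have [ik|ik] := eqVneq i k.
  subst k; have := segment_body (param_body i u) (param_body i t) hs.
  move=> h1 h2.
  have : (body T i `&` body T j) (param T i u + s *: (param T i t - param T i u)).
    by split.
  by rewrite (body_disjoint hT ij).
move=> h.
suff : (convex_hull (body T i `|` body T k) `&` body T j)
         (param T i u + s *: (param T k t - param T i u)).
  by rewrite (no_eclipse hT) // eq_sym.
split=> // B cB AB.
have [s0 s1] := andP hs.
have l0 : 0 <= 1 - s by rewrite subr_ge0.
have l1 : 1 - s <= 1 by rewrite gerBl.
have := cB (param T i u) (param T k t) (Itv01 l0 l1).
rewrite !inE => /(_ (AB _ (or_introl (param_body i u))) (AB _ (or_intror (param_body k t)))).
congr B; rewrite /= /conv /= /unstable.onem.
by apply: injective_projections => /=; rewrite /GRing.scale /=; ring.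
Qed.

(** Differentiate the constant squared length of the tangent. *)
Lemma tangent2_orth i u : dot (tangent T i u) (tangent2 i u) = 0.
Proof.
have h := is_derive_dot (is_derive_tangent i u) (is_derive_tangent i u).
have E : (fun t => dot (tangent T i t) (tangent T i t)) = cst 1.
  by apply/funext => t; rewrite -sqr_enorm (param_arclength hT) expr1n.
rewrite E in h; have := is_derive_unique h (is_derive_cst (1 : R) u 1).
rewrite [X in X + _]dotC; lra.
Qed.

Lemma enorm_normal i u : enorm (normal T i u) = 1.
Proof.
rewrite -(param_arclength hT i u) /enorm; congr Num.sqrt.
by rewrite /dot /normal /=; ring.
Qed.

Lemma tangent_frame i u x : x = dot x (tangent T i u) *: tangent T i u +
                                dot x (normal T i u) *: normal T i u.
Proof.
have := sqr_enorm (tangent T i u); rewrite (param_arclength hT) expr1n /dot.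
rewrite /normal; case: (tangent T i u) => a b /= h; case: x => x y /=.
by apply: injective_projections => /=; rewrite -[LHS]mulr1 h /GRing.scale /=; ring.
Qed.

(** Frenet formula; the sign is negative because [normal] points outward. *)
Lemma tangent2E i u : tangent2 i u = - curvature T i u *: normal T i u.
Proof.
have := tangent2_orth i u; rewrite /curvature.
move: (derive1n 2 (param T i) u) => x ox.
rewrite [LHS](tangent_frame i u) dotC ox scale0r add0r.
by congr (_ *: _); rewrite /dot /cross /normal /=; ring.
Qed.

Lemma curvature_periodic i u : curvature T i (u + perim T i) = curvature T i u.
Proof. by rewrite /curvature tangent_periodic tangent2_periodic. Qed.

End TableGeometry.

(** * Specular reflection *)

Section Reflection.
Context {R : realType}.

Definition direction (x : plane R) : plane R := (enorm x)^-1 *: x.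

Lemma enorm_direction (x : plane R) : x != 0 -> enorm (direction x) = 1.
Proof.
rewrite -enorm_gt0 => h; rewrite enormZ ger0_norm ?invr_ge0 ?enorm_ge0 //.
by rewrite mulVf // gt_eqF.
Qed.

Lemma directionK (x : plane R) : enorm x *: direction x = x.
Proof.
have [->|h] := eqVneq x 0; first by rewrite /direction !scaler0.
by rewrite /direction scalerA divff ?scale1r // gt_eqF // enorm_gt0.
Qed.

Lemma directionN (x : plane R) : direction (- x) = - direction x.
Proof. by rewrite /direction enormN scalerN. Qed.

Lemma cross0_parallel (v x : plane R) : enorm v = 1 -> cross v x = 0 -> x = dot x v *: v.
Proof.
move=> hv; have := sqr_enorm v; rewrite hv expr1n /dot /cross.
case: v {hv} => a b; case: x => x y /= h1 h2.
apply: injective_projections => /=; rewrite -[LHS]mulr1 h1 /GRing.scale /=.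
  by rewrite -[LHS]subr0 -[0 in LHS](mulr0 (- b)) -h2; ring.
by rewrite -[LHS]subr0 -[0 in LHS](mulr0 a) -h2; ring.
Qed.

Lemma int_norm_lt1 (k : int) : `|k| < 1 -> k = 0.
Proof. lia. Qed.

Lemma global_min_derive (f : R -> R) (u df : R) : (forall t, derivable f t 1) ->
  is_derive u 1 f df -> (forall t, f u <= f t) -> df = 0.
Proof.
move=> hf hd hmin; apply: (is_derive_unique hd).
apply: (@derive1_at_min _ f (u - 1) (u + 1)) => [|t _|| t _] //.
- by lra.
- by rewrite in_itv /=; apply/andP; split; lra.
Qed.

Context {m r : nat} (T : table R m).
Hypotheses (hr : (2 <= r)%N) (hT : billiard_table T r).

(** Injectivity is assumed on one half-open period only. Moving both parameters there shows that
    their difference is an integer multiple of the perimeter. *)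
Lemma param_eq_lt_perim i u t : param T i u = param T i t ->
  `|t - u| < perim T i -> t = u.
Proof.
move=> e; have L0 := perim_gt0 hT i.
have [k1 h1] := fundamental_period u L0; have [k2 h2] := fundamental_period t L0.
have := @param_inj _ _ _ _ hT i _ _ h1 h2.
rewrite !(periodicz (param_periodic hT i)) => /(_ e) e2.
have e3 : t - u = (k1 - k2)%:~R * perim T i by rewrite intrB mulrBl; lra.
rewrite e3 normrM [X in _ * X]gtr0_norm // gtr_pMl // -intr_norm.
rewrite (_ : 1 = 1%:~R) // ltr_int => h.
have k0 := int_norm_lt1 h.
by apply/eqP; rewrite -subr_eq0 e3 k0 mul0r.
Qed.

(** Stationarity equates the tangential components of the unit vectors v and w, so their normal
    components agree up to sign; since v and w differ, they are opposite and nonzero. What remains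
    is to exclude that a and b see the point from inside the obstacle. *)
Lemma specular i u (a b : plane R) :
  ~ body T i a -> ~ body T i b ->
  (forall t, enorm (param T i u - a) + enorm (param T i u - b) <=
             enorm (param T i t - a) + enorm (param T i t - b)) ->
  direction (param T i u - a) != direction (b - param T i u) ->
  [/\ dot (direction (param T i u - a)) (tangent T i u) =
      dot (direction (b - param T i u)) (tangent T i u),
      0 < dot (direction (b - param T i u)) (normal T i u) &
      dot (direction (param T i u - a)) (normal T i u) =
      - dot (direction (b - param T i u)) (normal T i u)].
Proof.
move=> na nb hmin.
set p := param T i u in hmin *; set v := direction _; set w := direction _ => vw.
have hp := param_body hT i u; rewrite -/p in hp.
have pne t c : ~ body T i c -> param T i t != c.
  by move=> nc; apply/eqP => e; apply: nc; rewrite -e; exact: (param_body hT).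
have pa : p - a != 0 by rewrite subr_eq0 pne.
have pb : b - p != 0 by rewrite subr_eq0 eq_sym pne.
have v1 : enorm v = 1 by exact: enorm_direction.
have w1 : enorm w = 1 by exact: enorm_direction.
have da := fun t : R => is_derive_enormB (pne t a na) (is_derive_param hr hT i t).
have db := fun t : R => is_derive_enormB (pne t b nb) (is_derive_param hr hT i t).
have st := global_min_derive _ (is_deriveD (da u) (db u)) hmin.
have {}st : dot v (tangent T i u) = dot w (tangent T i u).
  have := st (fun t => @ex_derive _ _ _ _ _ _ _ (is_deriveD (da t) (db t))).
  rewrite -/p (enormB p b) -[p - b]opprB (dotC _ (- _)) dotNl (dotC _ (p - a)).
  rewrite /v /w /direction !dotZl => h.
  by apply/eqP; rewrite -subr_eq0; apply/eqP; rewrite -[RHS]h; ring.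
have crossE x : cross x (tangent T i u) = dot x (normal T i u).
  by rewrite /cross /dot /normal /=; ring.
have nv : dot v (normal T i u) = - dot w (normal T i u).
  have := dot_cross_sqr v (tangent T i u); have := dot_cross_sqr w (tangent T i u).
  rewrite v1 w1 !crossE st => <- h.
  have /eqP : (dot v (normal T i u)) ^+ 2 = (dot w (normal T i u)) ^+ 2.
    by lra.
  rewrite eqf_sqr => /orP[/eqP e|/eqP //]; exfalso; move/eqP: vw; apply.
  by rewrite (tangent_frame hT i u v) (tangent_frame hT i u w) st e.
have n0 : dot w (normal T i u) != 0.
  apply/eqP => e; move/eqP: vw; apply.
  by rewrite (tangent_frame hT i u v) (tangent_frame hT i u w) st nv e oppr0.
split=> //; rewrite lt_neqAle eq_sym n0 leNgt; apply/negP => wneg.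
(* The zeros of g are the intersections of the boundary with the line of the incoming ray; the aim
   is to find one other than p. *)
pose g t := cross v (param T i t - p).
have dg (t : R) : is_derive t 1 g (cross v (tangent T i t)).
  have := is_derive_crossr v (is_deriveB (is_derive_param hr hT i t) (is_derive_cst p t 1)).
  by rewrite subr0.
have dg' := fun t : R => @ex_derive _ _ _ _ _ _ _ (dg t).
have gc : continuous g by move=> t; exact: (is_derive_continuous (dg t)).
have gu : g u = 0 by rewrite /g -/p subrr crossr0.
have gp t : g (t + perim T i) = g t by rewrite /g (param_periodic hT).
have L0 := perim_gt0 hT i.
have shift t : exists2 t', g t' = g t & u <= t' < u + perim T i.
  have [k /andP[h1 h2]] := fundamental_period (t - u) L0.
  exists (t + k%:~R * perim T i); first exact: periodicz.
  by apply/andP; split; lra.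
(* The derivative of g at u is nonzero, so u is not an extremum and the periodic g takes both signs
   strictly inside the period starting at u. The zero in between differs from u modulo the
   perimeter. *)
have [t1 g1 /andP[ut1 t1u]] : exists2 t, g t < 0 & u <= t < u + perim T i.
  apply: contrapT => h; have : forall t, g u <= g t.
    move=> t; rewrite gu leNgt; apply/negP => gt; apply: h.
    by have [t' e h] := shift t; exists t' => //; rewrite e.
  move/(global_min_derive dg' (dg u))/eqP.
  by rewrite crossE nv oppr_eq0 (negPf n0).
have [t2 g2 /andP[ut2 t2u]] : exists2 t, 0 < g t & u <= t < u + perim T i.
  apply: contrapT => h; have : forall t, (- g) u <= (- g) t.
    move=> t; rewrite /= lerN2 gu leNgt; apply/negP => gt; apply: h.
    by have [t' e h] := shift t; exists t' => //; rewrite e.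
  move/(global_min_derive (fun t => derivableN (dg' t)) (is_deriveN (dg u)))/eqP.
  by rewrite crossE nv opprK (negPf n0).
have nu t : g t != 0 -> u <= t -> u < t.
  by move=> gt; rewrite le_eqVlt => /orP[/eqP e|//]; rewrite -e gu eqxx in gt.
have {}ut1 := nu _ (ltr0_neq0 g1) ut1; have {}ut2 := nu _ (lt0r_neq0 g2) ut2.
have [t gt /andP[ut tu]] : exists2 t, g t = 0 & u < t < u + perim T i.
  have [le|le] := leP t1 t2.
    have [] := @IVT _ g t1 t2 0 le (continuous_subspaceT gc).
      by rewrite ge_min le_max (ltW g1) (ltW g2) ?orbT.
    move=> t; rewrite in_itv /= => /andP[h1 h2] gt; exists t => //.
    by apply/andP; split; lra.
  have [] := @IVT _ g t2 t1 0 (ltW le) (continuous_subspaceT gc).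
    by rewrite ge_min le_max (ltW g1) (ltW g2) ?orbT.
  move=> t; rewrite in_itv /= => /andP[h1 h2] gt; exists t => //.
  by apply/andP; split; lra.
have ptp : param T i t != p.
  apply/eqP => /esym e; have := param_eq_lt_perim e.
  by rewrite gtr0_norm; [move=> /(_ _)e2; have := e2 _; lra|lra].
have := cross0_parallel v1 gt; set s := dot _ v => es.
have := chord_left hT (param_body hT i t) ptp; rewrite -/p es crossZr crossC crossE nv opprK.
rewrite nmulr_lgt0 // => s0.
set d1 := enorm (p - a); set d2 := enorm (b - p).
have d10 : 0 < d1 by rewrite enorm_gt0.
have d20 : 0 < d2 by rewrite enorm_gt0.
have ea : p - a = d1 *: v by rewrite directionK.
have eb : b - p = d2 *: w by rewrite directionK.
(* The second intersection point lies behind p, at distance -s. Either a is between the two, hence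
   in the obstacle by convexity, or the ray from a meets that point first, and the path through it
   is strictly shorter because v and w differ. *)
have [le|lt] := leP d1 (- s).
  apply: na; have -> : a = p + (d1 / - s) *: (param T i t - p).
    rewrite es scalerA invrN mulrN mulNr divfK ?lt_eqF // scaleNr -ea.
    by rewrite opprB addrC subrK.
  apply: (segment_body hT) => //; first exact: (param_body hT).
  rewrite ler_pdivrMr ?oppr_gt0 // mul1r le andbT divr_ge0 //; lra.
have := hmin t; apply/negP; rewrite -ltNge.
have -> : param T i t - a = (d1 + s) *: v.
  by rewrite scalerDl -ea -es [RHS]addrC addrA subrK.
have -> : param T i t - b = s *: v + (- d2) *: w.
  by rewrite -es scaleNr -eb opprB addrA subrK.
rewrite (enormZ (d1 + s) v) v1 mulr1 ger0_norm; last lra.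
rewrite -/d1 (enormB p b) -/d2.
have := @enormD_lt R (s *: v) (- d2 *: w).
rewrite (enormZ s v) (enormZ (- d2) w) v1 w1 !mulr1 (ltr0_norm s0) normrN (gtr0_norm d20) (dotZl s v) (dotZr (- d2) w).
have := unit_dot_lt1 v1 w1 vw => h1 h2.
suff : s * (- d2 * dot v w) < - s * d2 by move/h2; lra.
have : 0 < - s * d2 by rewrite mulr_gt0 // oppr_gt0.
nra.
Qed.

End Reflection.

(** * The orbit of a minimizer *)

Section Orbit.
Context {R : realType} {m r : nat} (T : table R m).
Hypotheses (hr : (2 <= r)%N) (hT : billiard_table T r).
Context {n : nat} (xi : 'I_n -> 'I_m) (w : 'I_n -> R).
Hypotheses (hxi : admissible xi) (hw : minimizer T xi w).
Implicit Types j k : 'I_n.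

Definition vertex j : plane R := param T (xi j) (w j).
Definition velocity j : plane R := direction (vertex (ordS j) - vertex j).
Definition gap j : R := enorm (vertex (ordS j) - vertex j).

Lemma admissible_pred j : xi (ord_pred j) != xi j.
Proof. by have := hxi (ord_pred j); rewrite ord_predK. Qed.

Lemma ordS_neq j : ordS j != j.
Proof. by apply/eqP => e; have := hxi j; rewrite e eqxx. Qed.

Lemma ord_pred_neq j : ord_pred j != j.
Proof. by apply/eqP => e; have := admissible_pred j; rewrite e eqxx. Qed.

(** Only the summands of index j and [ordS j] involve the j-th parameter. They are distinct summands
    even for n = 2, where the predecessor and the successor of j coincide. *)
Lemma length_fun_split j : exists c, forall t,
  length_fun T xi (fun k => if k == j then t else w k) =
  enorm (param T (xi j) t - vertex (ord_pred j)) +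
  enorm (param T (xi j) t - vertex (ordS j)) + c.
Proof.
exists (\sum_(k < n | (k != j) && (k != ordS j))
  enorm (vertex k - vertex (ord_pred k))) => t.
rewrite /length_fun (bigD1 j) //= (bigD1 (ordS j)) ?ordS_neq //= addrA.
congr (_ + _ + _).
- by rewrite eqxx (negPf (ord_pred_neq j)).
- by rewrite ordSK eqxx (negPf (ordS_neq j)) enormB.
- apply: eq_bigr => k /andP[h1 h2]; rewrite (negPf h1).
  case: eqP => // e; move: h2; by rewrite -e ord_predK eqxx.
Qed.

Lemma vertex_min j t :
  enorm (param T (xi j) (w j) - vertex (ord_pred j)) +
  enorm (param T (xi j) (w j) - vertex (ordS j)) <=
  enorm (param T (xi j) t - vertex (ord_pred j)) +
  enorm (param T (xi j) t - vertex (ordS j)).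
Proof.
have [c hc] := length_fun_split j; have := hw (fun k => if k == j then t else w k).
have {1}-> : w = (fun k => if k == j then w j else w k).
  by apply/funext => k; case: eqP => // ->.
by rewrite !hc lerD2r.
Qed.

Lemma gap_gt0 j : 0 < gap j.
Proof.
rewrite /gap enorm_gt0 subr_eq0 eq_sym; exact: (param_neq hT _ _ (hxi j)).
Qed.

Lemma velocity_unit j : enorm (velocity j) = 1.
Proof. by rewrite enorm_direction // -enorm_gt0 gap_gt0. Qed.

Lemma gap_velocity j : gap j *: velocity j = vertex (ordS j) - vertex j.
Proof. exact: directionK. Qed.

(** Otherwise p_j would lie on the segment joining its two neighbours, against the no-eclipse
    condition; s below is its relative position there. *)
Lemma velocity_turns j : velocity (ord_pred j) != velocity j.
Proof.
apply/eqP => e; have hd := gap_gt0 j; have hd' := gap_gt0 (ord_pred j).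
have := gap_velocity j; have := gap_velocity (ord_pred j).
rewrite ord_predK e => e1 e2.
set s := gap (ord_pred j) / (gap (ord_pred j) + gap j).
have s01 : 0 <= s <= 1.
  rewrite /s divr_ge0 ?addr_ge0 ?(ltW hd) ?(ltW hd') //=.
  by rewrite ler_pdivrMr ?addr_gt0 // mul1r lerDl (ltW hd).
have := segment_no_eclipse hT (u := w (ord_pred j)) (t := w (ordS j)) (admissible_pred j)
  (hxi j) s01.
apply; have -> : param T (xi (ordS j)) (w (ordS j)) -
    param T (xi (ord_pred j)) (w (ord_pred j)) =
    (gap (ord_pred j) + gap j) *: velocity j.
  by rewrite scalerDl e1 e2 [RHS]addrC addrA subrK.
rewrite scalerA /s divfK ?gt_eqF ?addr_gt0 // e1 /vertex addrC subrK.
exact: (param_body hT).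
Qed.

Lemma specular_orbit j :
  [/\ dot (velocity (ord_pred j)) (tangent T (xi j) (w j)) =
      dot (velocity j) (tangent T (xi j) (w j)),
      0 < dot (velocity j) (normal T (xi j) (w j)) &
      dot (velocity (ord_pred j)) (normal T (xi j) (w j)) =
      - dot (velocity j) (normal T (xi j) (w j))].
Proof.
have := velocity_turns j; rewrite /velocity ord_predK; apply: (specular hr hT).
- exact: (not_in_other hT (admissible_pred j)).
- by apply: (not_in_other hT); rewrite eq_sym hxi.
- exact: vertex_min.
Qed.

(** The obstacle just left and the one about to be hit lie behind their tangent lines, while the
    flight stays in front of both; any other obstacle is avoided by the no-eclipse condition. *)
Lemma orbit_next_reflection j :
  next_reflection T (vertex j) (velocity j) (vertex (ordS j)).
Proof.
split; first by exists (xi (ordS j)) => //; exact: (param_body hT).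
have hg := gap_gt0 j; exists (gap j); split=> //.
  by rewrite gap_velocity addrC subrK.
move=> s /andP[s0 sg] [k _].
have [_ nj _] := specular_orbit j; have [_ _ njS] := specular_orbit (ordS j).
have [_ pS _] := specular_orbit (ordS j); rewrite ordSK in njS.
have v0 : velocity j != 0 by rewrite -enorm_gt0 velocity_unit.
have crossE i u x : cross (tangent T i u) x = - dot x (normal T i u).
  by rewrite /cross /dot /normal /=; ring.
have [-> h|kj] := eqVneq k (xi j).
  have : 0 < cross (tangent T (xi j) (w j)) (vertex j + s *: velocity j - vertex j).
    apply: (chord_left hT h); rewrite addrC -subr_eq0 addrK scaler_eq0.
    by rewrite negb_or gt_eqF.
  have -> : vertex j + s *: velocity j - vertex j = s *: velocity j.
    by rewrite addrAC subrr add0r.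
  by rewrite crossZr crossE pmulr_rgt0 // oppr_gt0 ltNge (ltW nj).
have [-> h|kS] := eqVneq k (xi (ordS j)).
  have e : vertex j + s *: velocity j - vertex (ordS j) = (s - gap j) *: velocity j.
    by rewrite scalerBl gap_velocity opprB addrA [vertex j + _]addrC.
  have : 0 < cross (tangent T (xi (ordS j)) (w (ordS j)))
               (vertex j + s *: velocity j - vertex (ordS j)).
    apply: (chord_left hT h); rewrite -subr_eq0 e scaler_eq0.
    by rewrite negb_or v0 lt_eqF // subr_lt0.
  by rewrite e crossZr crossE nmulr_rgt0 ?subr_lt0 // njS opprK ltNge (ltW pS).
have s01 : 0 <= s / gap j <= 1.
  by rewrite divr_ge0 ?(ltW s0) ?(ltW hg) //= ler_pdivrMr // mul1r (ltW sg).
rewrite eq_sym in kj.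
have := segment_no_eclipse hT (u := w j) (t := w (ordS j)) kj kS s01.
by rewrite -gap_velocity scalerA divfK ?gt_eqF.
Qed.

Lemma reflection_law j : velocity j =
  velocity (ord_pred j) - (2 * dot (velocity (ord_pred j)) (normal T (xi j) (w j)))
    *: normal T (xi j) (w j).
Proof.
have [h1 _ h2] := specular_orbit j.
rewrite [LHS](tangent_frame hT (xi j) (w j)).
rewrite [X in _ = X - _](tangent_frame hT (xi j) (w j)) h1 h2 -addrA -scalerBl.
by congr (_ + _ *: _); ring.
Qed.

(** Trajectories are indexed by [int], so the periodic orbit is wound around its cycle in both
    directions. [Negz a] is -(a + 1), hence the [a.+1] predecessors. *)
Definition ord_shift (k : int) j : 'I_n :=
  match k with Posz a => iter a (@ordS n) j | Negz a => iter a.+1 (@ord_pred n) j end.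

Lemma ord_shiftD1 (k : int) j : ord_shift (k + 1) j = ordS (ord_shift k j).
Proof.
case: k => a; first by have -> : Posz a + 1 = Posz a.+1 by lia.
case: a => [|a]; first by rewrite (_ : Negz 0 + 1 = 0) //= ord_predK.
have -> : Negz a.+1 + 1 = Negz a by lia.
by rewrite /= ord_predK.
Qed.

Lemma orbit_M0 j : M0 T (vertex j, velocity j).
Proof.
exists (fun k : int => xi (ord_shift k j)), (fun k : int => w (ord_shift k j)),
  (fun k : int => velocity (ord_shift k j)); split=> // k; split.
- exact: velocity_unit.
- by rewrite ord_shiftD1; exact: orbit_next_reflection.
- by rewrite ord_shiftD1 [LHS]reflection_law ordSK.
Qed.

Lemma cos_reflection_angle j :
  cos (reflection_angle T xi w j) = dot (velocity j) (normal T (xi j) (w j)).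
Proof.
rewrite /reflection_angle /angle (enorm_normal hT) mulr1 mulrC -dotZl.
have := dot_le (velocity j) (normal T (xi j) (w j)).
rewrite velocity_unit (enorm_normal hT) mulr1 => h.
by rewrite acosK // in_itv /= -ler_norml.
Qed.

End Orbit.

(** * Positivity of [d_min] and [kappa_min], and comparison with an orbit *)

Section Minima.
Context {R : realType} {m r : nat} (T : table R m).
Hypotheses (hr : (2 <= r)%N) (hT : billiard_table T r).

Lemma continuous_dotB : continuous (fun p : plane R * plane R => enorm (p.1 - p.2)).
Proof.
have h1 : continuous (fun p : plane R * plane R => p.1.1 - p.2.1).
  move=> p; apply: cvgB; [apply: (cvg_comp fst fst)|apply: (cvg_comp snd fst)];
    by [exact: cvg_fst|exact: cvg_snd].
have h2 : continuous (fun p : plane R * plane R => p.1.2 - p.2.2).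
  move=> p; apply: cvgB; [apply: (cvg_comp fst snd)|apply: (cvg_comp snd snd)];
    by [exact: cvg_fst|exact: cvg_snd].
move=> p; apply: (cvg_comp (fun p : plane R * plane R => dot (p.1 - p.2) (p.1 - p.2)) Num.sqrt);
  last exact: sqrt_continuous.
by apply: cvgD; apply: cvgM; [exact: h1|exact: h1|exact: h2|exact: h2].
Qed.

(** Each pair is treated by compactness. Phrasing the bound for all small positive d lets the
    finitely many pairs share one d. *)
Lemma bodies_apart : exists2 d : R, 0 < d & forall i j x y, i != j ->
  body T i x -> body T j y -> d <= enorm (y - x).
Proof.
have h i j : \forall d \near 0^'+, i != j -> forall x y,
    body T i x -> body T j y -> d <= enorm (y - x).
  have [->|ij] := eqVneq i j; first exact: nearW.
  have [[x0 hx0] [y0 hy0]] : body T i !=set0 /\ body T j !=set0.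
    by split; [exists (param T i 0)|exists (param T j 0)]; exact: (param_body hT).
  have cp : compact (body T j `*` body T i).
    by apply: compact_setX; exact: (body_compact hT).
  have [|c hc hmin] := compact_EVT_min _ cp (continuous_subspaceT continuous_dotB).
    by exists (y0, x0).
  have {}hc : body T j c.1 /\ body T i c.2 by move: hc; rewrite inE.
  have c0 : 0 < enorm (c.1 - c.2).
    rewrite enorm_gt0 subr_eq0; apply/eqP => e.
    have : (body T i `&` body T j) c.2 by split; [exact: hc.2|rewrite -e; exact: hc.1].
    by rewrite (body_disjoint hT ij).
  near=> d => _ x y hx hy; apply: (@le_trans _ _ (enorm (c.1 - c.2))).
    by near: d; exact: nbhs_right_le.
  by apply: (hmin (y, x)); rewrite inE.
have {}h : \forall d \near 0^'+, forall ij : 'I_m * 'I_m, ij.1 != ij.2 -> forall x y,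
    body T ij.1 x -> body T ij.2 y -> d <= enorm (y - x).
  by apply: filter_forall => -[i j]; exact: h.
have [d [h1 h2]] := filter_ex (filterI (nbhs_right_gt 0) h).
by exists d => // i j x y ne hx hy; exact: (h2 (i, j)).
Unshelve. all: by end_near. Qed.

Lemma curvature_bound : exists2 d : R, 0 < d & forall i u, d <= curvature T i u.
Proof.
have h i : \forall d \near 0^'+, forall u, d <= curvature T i u.
  have cc : continuous (curvature T i).
    move=> u; rewrite /curvature /cross.
    have c1 := is_derive_continuous (is_derive_tangent hr hT i u).
    have c2 := tangent2_continuous hr hT (x := u) (i := i).
    apply: cvgB; apply: cvgM.
    - exact: (cvg_comp _ _ c1 cvg_fst).
    - exact: (cvg_comp _ _ c2 cvg_snd).
    - exact: (cvg_comp _ _ c1 cvg_snd).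
    - exact: (cvg_comp _ _ c2 cvg_fst).
  have L0 := perim_gt0 hT i.
  have [c _ hmin] := EVT_min (ltW L0) (continuous_subspaceT cc).
  have c0 := curvature_gt0 hT i c.
  near=> d => u; apply: (@le_trans _ _ (curvature T i c)).
    by near: d; exact: nbhs_right_le.
  have [k /andP[k1 k2]] := fundamental_period u L0.
  have <- : curvature T i (u + k%:~R * perim T i) = curvature T i u.
    exact: (periodicz (f := curvature T i) (curvature_periodic hT i)).
  apply: hmin.
  by rewrite in_itv /= k1 (ltW k2).
have [d [h1 h2]] := filter_ex (filterI (nbhs_right_gt 0) (filter_forall _ h)).
by exists d => // i u; exact: h2.
Unshelve. all: by end_near. Qed.

(** Two consecutive reflections occur on different obstacles: otherwise the midpoint of the flight
    would be in the obstacle by convexity. *)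
Lemma flight_bound : exists2 d : R, 0 < d &
  forall q v q', M0 T (q, v) -> next_reflection T q v q' -> d <= enorm (q' - q).
Proof.
have [d d0 hd] := bodies_apart; exists d => // q v q' [i [u [vv [_ /= -> _]]]].
move=> [[k _ hk] [t [t0 e hs]]].
have [ik|ik] := eqVneq (i 0) k; last exact: (hd _ _ _ _ ik (param_body hT _ _) hk).
exfalso; apply: (hs (t / 2)).
  by apply/andP; split; lra.
exists k => //; rewrite -ik in hk *.
have h2 : 0 <= (2^-1 : R) <= 1 by rewrite invr_ge0 invf_le1 ?ler1n ?ler0n ?ltr0n.
have := segment_body hT (param_body hT (i 0) (u 0)) hk h2.
by rewrite e addrAC subrr add0r scalerA mulrC.
Qed.

Context {n : nat} (xi : 'I_n -> 'I_m) (w : 'I_n -> R).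
Hypotheses (hxi : admissible xi) (hw : minimizer T xi w).

(** The orbit through index j shows that the set is nonempty; the infimum of an empty set would take
    the default value 0. *)
Lemma d_min_gt0 (j : 'I_n) : 0 < d_min T.
Proof.
have [d d0 hd] := flight_bound; apply: (lt_le_trans d0); apply: lb_le_inf.
  exists (gap T xi w j), (vertex T xi w j), (velocity T xi w j), (vertex T xi w (ordS j)).
  by split=> //; [exact: (orbit_M0 hr)|exact: (orbit_next_reflection hr)].
by move=> _ [q [v [q' [h1 h2 ->]]]]; exact: (hd _ v).
Qed.

Lemma d_min_le j : d_min T <= gap T xi w j.
Proof.
have [d d0 hd] := flight_bound; apply: ge_inf.
  by exists d => _ [q [v [q' [h1 h2 ->]]]]; exact: (hd _ v).
exists (vertex T xi w j), (velocity T xi w j), (vertex T xi w (ordS j)).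
by split=> //; [exact: (orbit_M0 hr)|exact: (orbit_next_reflection hr)].
Qed.

Lemma kappa_min_gt0 (j : 'I_n) : 0 < kappa_min T.
Proof.
have [d d0 hd] := curvature_bound; apply: (lt_le_trans d0); apply: lb_le_inf.
  exists (curvature T (xi j) (w j)), (xi j), (w j), (velocity T xi w j).
  by split=> //; exact: (orbit_M0 hr).
by move=> _ [i [u [v [_ ->]]]].
Qed.

Lemma kappa_min_le j : kappa_min T <= curvature T (xi j) (w j).
Proof.
have [d d0 hd] := curvature_bound; apply: ge_inf.
  by exists d => _ [i [u [v [_ ->]]]].
by exists (xi j), (w j), (velocity T xi w j); split=> //; exact: (orbit_M0 hr).
Qed.

End Minima.

(** * Calculus relative to an interval *)

Section WithinCalculus.
Context {R : realType}.
Implicit Types (Y : set R) (f g : R -> R) (x y a : R).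

(** Neighbourhoods relative to Y with an explicit radius, as needed in estimates. Asking for all
    small radii makes conjunctions a matter of intersecting filters. In [near2] only the second
    variable is confined to Y. *)
Definition near1 Y a (A : R -> Prop) : Prop :=
  \forall d \near 0^'+, forall y, `|y - a| < d -> Y y -> A y.

Definition near2 Y u0 a (A : R -> R -> Prop) : Prop :=
  \forall d \near 0^'+, forall u y, `|u - u0| < d -> `|y - a| < d -> Y y -> A u y.

Lemma near1P Y a A : near1 Y a A <-> \forall y \near within Y (nbhs a), A y.
Proof.
split=> [h|].
  have [d [d0 hd]] := filter_ex (filterI (nbhs_right_gt 0) h).
  apply/nbhs_ballP; exists d => //= y; rewrite /ball /= distrC => ya Yy.
  exact: hd.
move=> /nbhs_ballP[d /= d0 hd]; rewrite /near1; near=> e => y ye Yy.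
apply: (hd y) => //; rewrite /ball /= distrC; apply: (lt_trans ye).
by near: e; exact: nbhs_right_lt.
Unshelve. all: by end_near. Qed.

Lemma near1_ball Y a c : 0 < c -> near1 Y a (fun y => `|y - a| < c).
Proof.
move=> c0; rewrite /near1; near=> d => y yd _; apply: (lt_trans yd).
by near: d; exact: nbhs_right_lt.
Unshelve. all: by end_near. Qed.

Lemma near2_cvg Y u0 a (f : R -> R -> R) l :
  (fun p : R * R => f p.1 p.2) @ within [set p | Y p.2] (nbhs (u0, a)) --> l ->
  forall e, 0 < e -> near2 Y u0 a (fun u y => `|f u y - l| < e).
Proof.
move=> /cvgrPdist_lt h e e0; have := h e e0.
move=> /nbhs_ballP[d /= d0 hd]; rewrite /near2; near=> c => u y uc yc Yy.
have cd : c < d by near: c; exact: nbhs_right_lt.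
rewrite distrC; apply: (hd (u, y)) => //; split; rewrite /ball /= distrC.
  exact: lt_trans cd.
exact: lt_trans cd.
Unshelve. all: by end_near. Qed.

Lemma near2_ex Y u0 a A : near2 Y u0 a A -> exists2 d, 0 < d &
  forall u y, `|u - u0| < d -> `|y - a| < d -> Y y -> A u y.
Proof.
move=> h; have [d [d0 hd]] := filter_ex (filterI (nbhs_right_gt 0) h).
by exists d.
Qed.

Lemma near2_intro Y u0 a d (A : R -> R -> Prop) : 0 < d ->
  (forall u y, `|u - u0| < d -> `|y - a| < d -> Y y -> A u y) -> near2 Y u0 a A.
Proof.
move=> d0 hA; rewrite /near2; near=> c => u y uc yc Yy.
have cd : c < d by near: c; exact: nbhs_right_lt.
by apply: hA => //; exact: lt_trans cd.
Unshelve. all: by end_near. Qed.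

Lemma near1_ex Y a A : near1 Y a A -> exists2 d, 0 < d &
  forall y, `|y - a| < d -> Y y -> A y.
Proof.
move=> h; have [d [d0 hd]] := filter_ex (filterI (nbhs_right_gt 0) h).
by exists d.
Qed.

Lemma near1_near2 Y u0 a A : near1 Y a A -> near2 Y u0 a (fun _ y => A y).
Proof. by move=> /near1_ex[d d0 hd]; apply: (near2_intro d0) => u y _; exact: hd. Qed.

Lemma near2_slice Y u0 a A : near2 Y u0 a A -> near1 Y a (A u0).
Proof.
move=> /near2_ex[d d0 hd]; rewrite /near1; near=> c => y yc Yy.
apply: hd => //; first by rewrite subrr normr0.
by apply: (lt_trans yc); near: c; exact: nbhs_right_lt.
Unshelve. all: by end_near. Qed.

Lemma near1I Y a A B : near1 Y a A -> near1 Y a B -> near1 Y a (fun y => A y /\ B y).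
Proof.
by rewrite /near1; apply: filterS2 => d hA hB y h1 h2; split; [apply: hA|apply: hB].
Qed.

Lemma near2W Y u0 a A B : (forall u y, A u y -> B u y) -> near2 Y u0 a A -> near2 Y u0 a B.
Proof.
by move=> h; rewrite /near2; apply: filterS => d hd u y h1 h2 h3; apply/h/hd.
Qed.

Lemma near2I Y u0 a A B : near2 Y u0 a A -> near2 Y u0 a B ->
  near2 Y u0 a (fun u y => A u y /\ B u y).
Proof.
by rewrite /near2; apply: filterS2 => d hA hB u y h1 h2 h3; split; [apply: hA|apply: hB].
Qed.

Lemma is_derive_withinP Y f a l : is_derive_within Y f a l <->
  forall e, 0 < e -> near1 Y a (fun y => `|f y - f a - (y - a) * l| <= e * `|y - a|).
Proof.
rewrite /is_derive_within; split.
  move=> /cvgrPdist_le h e e0; have := h e e0; rewrite /within /= => /nbhs_ballP[d /= d0 hd].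
  rewrite /near1; near=> c => y yc Yy; have [->|ya] := eqVneq y a.
    by rewrite !subrr mul0r subr0 !normr0 mulr0.
  have := hd y _ ya; rewrite /ball /= distrC => /(_ (lt_trans yc _) Yy).
  have cd : c < d by near: c; exact: nbhs_right_lt.
  move=> /(_ cd); rewrite distrC.
  have ya0 : y - a != 0 by rewrite subr_eq0.
  rewrite -(ler_pM2r (x := `|y - a|)) ?normr_gt0 // -normrM mulrBl /GRing.scale /=.
  by rewrite mulrAC mulVf // mul1r [l * _]mulrC.
move=> h; apply/cvgrPdist_le => e e0.
have [d [d0 hd]] := filter_ex (filterI (nbhs_right_gt 0) (h e e0)).
apply/nbhs_ballP; exists d => //= y; rewrite /ball /= distrC => yd ya Yy.
have := hd y yd Yy.
have ya0 : y - a != 0 by rewrite subr_eq0.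
move=> h1; rewrite -(ler_pM2r (x := `|y - a|)) ?normr_gt0 // -normrM.
apply: le_trans h1.
have H (p q : R) : p = - q -> `|p| <= `|q| by move=> ->; rewrite normrN.
by apply: H; rewrite /GRing.scale /=; field.
Unshelve. all: by end_near. Qed.

Lemma is_derive_within_cvg Y f a l : Y a -> is_derive_within Y f a l ->
  f y @[y --> within Y (nbhs a)] --> f a.
Proof.
move=> Ya /is_derive_withinP/(_ 1 ltr01)/near1P h.
apply/cvgrPdist_lt => e e0; near=> y.
have hy : `|f y - f a - (y - a) * l| <= 1 * `|y - a| by near: y; exact: h.
have ya : `|y - a| < e / (1 + `|l|).
  near: y; apply/near1P/near1_ball.
  by rewrite divr_gt0 // ltr_pwDl.
rewrite distrC.
have := ler_normD (f y - f a - (y - a) * l) ((y - a) * l); rewrite subrK normrM.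
move: ya; rewrite ltr_pdivlMr ?ltr_pwDl // => ya; lra.
Unshelve. all: by end_near. Qed.

(** The open interval between x and y consists of interior points of Y, where derivatives within Y
    are ordinary ones; at x and y only continuity is required. *)
Lemma MVT_within Y f f' x y : is_interval Y -> Y x -> Y y -> x < y ->
  (forall z, Y z -> is_derive_within Y f z (f' z)) ->
  exists2 z, x < z < y & f y - f x = f' z * (y - x).
Proof.
move=> iY Yx Yy xy hf.
have hin z : x <= z <= y -> Y z by exact: (iY x y).
have [] := @MVT _ f f' x y xy.
- move=> z; rewrite in_itv /= => zxy; apply/is_derive1_cvg.
  have Yz : Y z by apply: hin; case/andP: zxy => *; rewrite !ltW.
  have nz : \forall t \near z, Y t.
    have : \forall t \near z, t \in `]x, y[ by apply: near_in_itvoo; rewrite in_itv.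
    by apply: filterS => t; rewrite in_itv /= => /andP[h1 h2]; apply: hin; rewrite !ltW.
  have := hf z Yz; rewrite /is_derive_within => /cvgrPdist_lt h.
  apply/cvgrPdist_lt => e e0.
  move: nz (h e e0) => /nbhs_ballP[d1 /= d10 h1] /nbhs_ballP[d2 /= d20 h2].
  apply/nbhs_ballP; exists (Num.min d1 d2); rewrite /= ?lt_min ?d10 //.
  move=> t; rewrite /ball /= sub0r normrN lt_min => /andP[t1 t2] t0.
  have e1 : `|z - (t + z)| = `|t| by rewrite opprD addrCA subrr addr0 normrN.
  have := h2 (t + z); rewrite /ball /= e1 => /(_ t2) h3.
  have := h3 _ (h1 (t + z) _); rewrite /ball /= e1 addrK; apply=> //.
  by rewrite -subr_eq0 addrK.
- apply/subspace_continuousP => z; rewrite /= in_itv /= => zxy.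
  have Yz := hin _ zxy.
  have := is_derive_within_cvg Yz (hf z Yz).
  move=> h; apply: cvg_trans h; apply: cvg_app => A hA.
  change (\forall t \near z, `[x, y]%classic t -> A t).
  have : \forall t \near z, Y t -> A t by exact: hA.
  by apply: filterS => t ht; rewrite /= in_itv /= => /hin; exact: ht.
move=> z; rewrite in_itv /= => h e; by exists z.
Qed.

Lemma mean_value_estimate f f' x y T e :
  (forall z, is_derive (z : R) 1 f (f' z)) ->
  (forall z, `|z - x| <= `|y - x| -> `|f' z - T| <= e) ->
  `|f y - f x - (y - x) * T| <= e * `|y - x|.
Proof.
move=> hf hT.
have fc : continuous f by move=> z; exact: (is_derive_continuous (hf z)).
have H u v : u <= v -> (forall z, u <= z <= v -> `|f' z - T| <= e) ->
    `|f v - f u - (v - u) * T| <= e * (v - u).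
  move=> uv h; have [] := @MVT_segment _ f f' u v uv.
    exact: continuous_subspaceT.
  move=> z; rewrite in_itv /= => /h hz ->.
  by rewrite mulrC -mulrBr normrM ger0_norm ?subr_ge0 // mulrC ler_wpM2r ?subr_ge0.
have [xy|yx] := leP x y.
  rewrite [X in e * X]ger0_norm ?subr_ge0 //.
  apply: H => // z /andP[h1 h2]; apply: hT.
  by rewrite !ger0_norm ?subr_ge0 // lerB.
rewrite [X in e * X]ltr0_norm ?subr_lt0 // opprB.
have -> : f y - f x - (y - x) * T = - (f x - f y - (x - y) * T) by ring.
rewrite normrN; apply: H; first exact: ltW.
move=> z /andP[h1 h2]; apply: hT.
by rewrite ler0_norm ?subr_le0 // ltr0_norm ?subr_lt0 // !opprB lerB.
Qed.

Lemma derive_estimate f u D c k d : 0 < d -> is_derive (u : R) 1 f D ->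
  (forall h, `|h| < d -> `|f (h + u) - f u - h * c| <= k * `|h|) -> `|D - c| <= k.
Proof.
move=> d0 /is_derive1_cvg hf hk.
have hc : (fun h : R => h^-1 *: (f (h + u) - f u) - c) @ 0^' --> D - c.
  by apply: cvgB => //; exact: cvg_cst.
apply: (cvgr_to_le (cvg_norm hc)).
apply/nbhs_ballP; exists d => //= h; rewrite /ball /= sub0r normrN => hd h0.
rewrite -(ler_pM2r (x := `|h|)) ?normr_gt0 // -normrM.
apply: le_trans (hk h hd).
have H (p q : R) : p = q -> `|p| <= `|q| by move=> ->.
by apply: H; rewrite /GRing.scale /=; field.
Qed.

(* The increment of [F (h + u0) y - F u0 y] in y is computed by the mean value
   theorem, first in y and then in u, before letting h tend to 0. *)
Lemma mixed_derive Y a (u0 : R) (F F1 Fy Fy1 : R -> R -> R) :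
  is_interval Y -> Y a ->
  (forall (u : R) y, Y y -> is_derive u 1 (F ^~ y) (F1 u y)) ->
  (forall u y, Y y -> is_derive_within Y (F u) y (Fy u y)) ->
  (forall (u : R) y, Y y -> is_derive u 1 (Fy ^~ y) (Fy1 u y)) ->
  (forall e, 0 < e -> near2 Y u0 a (fun u y => `|Fy1 u y - Fy1 u0 a| < e)) ->
  is_derive_within Y (F1 u0) a (Fy1 u0 a).
Proof.
move=> iY Ya hF1 hFy hFy1 hc; apply/is_derive_withinP => e e0.
have h0 : \forall d \near (0 : R)^'+, 0 < d by exact: nbhs_right_gt.
rewrite /near1; apply: filterS2 h0 (hc e e0) => d d0 hd y yd Yy.
have [->|ya] := eqVneq y a; first by rewrite !subrr mul0r subrr normr0 mulr0.
have hD := is_deriveB (hF1 u0 y Yy) (hF1 u0 a Ya).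
apply: (derive_estimate d0 hD) => h hh /=.
pose psi t := F (h + u0) t - F u0 t.
have hpsi z : Y z -> is_derive_within Y psi z (Fy (h + u0) z - Fy u0 z).
  move=> Yz; apply/is_derive_withinP => e' e'0.
  have e2 : 0 < e' / 2 by rewrite divr_gt0.
  have /is_derive_withinP/(_ _ e2) := hFy (h + u0) z Yz.
  have /is_derive_withinP/(_ _ e2) := hFy u0 z Yz.
  rewrite /near1; apply: filterS2 => d' h1 h2 t td Yt.
  have := h1 t td Yt; have {}h1 := h2 t td Yt => {}h2.
  have := ler_normB (F (h + u0) t - F (h + u0) z - (t - z) * Fy (h + u0) z)
    (F u0 t - F u0 z - (t - z) * Fy u0 z).
  rewrite /psi [X in `|X| <= _ -> _](_ : _ =
    F (h + u0) t - F u0 t - (F (h + u0) z - F u0 z) -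
    (t - z) * (Fy (h + u0) z - Fy u0 z)); last by ring.
  lra.
have [t [ta Yt e1]] : exists t, [/\ `|t - a| < d, Y t &
    psi y - psi a = (Fy (h + u0) t - Fy u0 t) * (y - a)].
  move: ya; rewrite neq_lt => /orP[lt|lt].
    have [t /andP[t1 t2] e1] := MVT_within iY Yy Ya lt hpsi.
    exists t; split; last by rewrite -opprB e1; ring.
      by move: yd; rewrite !ltr0_norm ?subr_lt0 //; lra.
    by apply: (iY y a Yy Ya); rewrite !ltW.
  have [t /andP[t1 t2] e1] := MVT_within iY Ya Yy lt hpsi.
  exists t; split=> //.
    by move: yd; rewrite !gtr0_norm ?subr_gt0 //; lra.
  by apply: (iY a y Ya Yy); rewrite !ltW.
have := @mean_value_estimate (Fy ^~ t) (Fy1 ^~ t) u0 (h + u0) (Fy1 u0 a) e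
  (fun z => hFy1 z t Yt).
rewrite addrK => /(_ _) h2.
have {}h2 : `|Fy (h + u0) t - Fy u0 t - h * Fy1 u0 a| <= e * `|h|.
  by apply: h2 => z hz; apply/ltW/hd => //; exact: le_lt_trans hh.
have -> : F (h + u0) y - F (h + u0) a - (F u0 y - F u0 a) - h * ((y - a) * Fy1 u0 a) =
  (Fy (h + u0) t - Fy u0 t - h * Fy1 u0 a) * (y - a).
  by rewrite /psi in e1; lra.
rewrite normrM mulrAC; exact: ler_wpM2r.
Qed.

(** Here p is the extension with period L y of the continuous q. Trouble arises only at u0 = 0 or u0
    = L a, where u may leave [0, L y]; a shift by one period then brings it near the other end, at
    which q has the same value for y = a. *)
Lemma seam_continuity Y a (p q : R -> R -> R) (L : R -> R) u0 :
  Y a -> 0 <= u0 <= L a -> (forall y, Y y -> 0 < L y) ->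
  (forall e, 0 < e -> near1 Y a (fun y => `|L y - L a| < e)) ->
  (forall u y, Y y -> p (u + L y) y = p u y) ->
  (forall u y, Y y -> 0 <= u <= L y -> p u y = q u y) ->
  (forall u1 e, 0 < e -> near2 Y u1 a (fun u y => `|q u y - q u1 a| < e)) ->
  forall e, 0 < e -> near2 Y u0 a (fun u y => `|p u y - q u0 a| <= e).
Proof.
move=> Ya /andP[u00 u0L] Lpos Lnear per pq hq e e0.
have La := Lpos a Ya.
have q0L : q 0 a = q (L a) a.
  by rewrite -!pq ?lexx ?(ltW La) // -[L a]add0r per.
have [d1 d10 h1] := near2_ex (hq u0 e e0).
have [d2 d20 h2] := near2_ex (hq 0 e e0).
have [d3 d30 h3] := near2_ex (hq (L a) e e0).
(* The halves leave room for the errors of both u and the period. L a / 3 keeps a shifted parameter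
   inside [0, L y]. The last term forces u <= L y when u0 < L a. *)
pose c := Num.min (Num.min (d2 / 2) (d3 / 2))
  (Num.min (L a / 3) (if u0 < L a then (L a - u0) / 2 else 1)).
have p4 : 0 < (if u0 < L a then (L a - u0) / 2 else 1).
  by case: (ltP u0 (L a)) => [h|_] //; rewrite divr_gt0 // subr_gt0.
have c0 : 0 < c by rewrite !lt_min p4 !divr_gt0.
have [d4 d40 h4] := near1_ex (Lnear c c0).
(* The last term forces 0 < u when 0 < u0. *)
pose d := Num.min (Num.min (Num.min d1 c) (Num.min d2 d3))
  (Num.min d4 (if 0 < u0 then u0 else 1)).
have d0 : 0 < d.
  by rewrite /d !lt_min d10 d20 d30 d40 p4 !divr_gt0 //=; case: (ltP 0 u0).
apply: (near2_intro d0) => u y; rewrite /d !lt_min.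
move=> /andP[/andP[/andP[u1 u2] /andP[u3 u4]] /andP[_ u5]].
move=> /andP[/andP[/andP[y1 _] /andP[y3 y4]] /andP[y5 _]] Yy.
have := h4 y y5 Yy; rewrite /c !lt_min => /andP[/andP[l1 l2] /andP[l3 l4]].
move: u2 => /andP[/andP[v1 v2] /andP[v3 v4]].
have Ly := Lpos y Yy; clear h4 d0 d40 p4 c0 d c.
have [un|un] := ltP u 0.
  have z0 : u0 = 0.
    apply/eqP; rewrite eq_le u00 andbT leNgt; apply/negP => h; move: u5; rewrite h.
    by rewrite distrC ltr_norml => /andP[_]; lra.
  rewrite z0 subr0 in v1 v2 v3 *; rewrite ltr0_norm // in v1 v2 v3.
  move: l2 l3; rewrite !ltr_norml => /andP[l2 l2'] /andP[l3 l3'].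
  rewrite -per // pq //; last by apply/andP; split; lra.
  rewrite q0L; apply/ltW/h3 => //.
  by rewrite ltr_norml; apply/andP; split; lra.
have [uL|uL] := leP u (L y).
  by rewrite pq // ?un //; apply/ltW/h1.
have z0 : u0 = L a.
  apply/eqP; rewrite eq_le u0L /= leNgt; apply/negP => h; move: v4 l4; rewrite h.
  by rewrite !ltr_norml => /andP[_ ?] /andP[? _]; lra.
rewrite z0 in v1 v2 v3 *.
move: l1 l3 v1 v3; rewrite !ltr_norml.
move=> /andP[l1 l1'] /andP[l3 l3'] /andP[v1 v1'] /andP[v3 v3'].
rewrite -(subrK (L y) u) per // pq //; last by apply/andP; split; lra.
rewrite -q0L; apply/ltW/h2 => //.
by rewrite subr0 ltr_norml; apply/andP; split; lra.
Qed.

(** The projection on [0, L] does not increase distances to points of that interval; a point u0 of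
    [0, L0] may miss it, by at most |L - L0|. *)
Lemma clamp_spec (L u : R) : 0 <= L -> exists v, [/\ 0 <= v <= L,
  forall u0 L0, 0 <= u0 <= L0 -> `|v - u0| <= `|u - u0| + `|L - L0| &
  0 <= u <= L -> v = u].
Proof.
move=> L0; exists (Num.max 0 (Num.min u L)).
have [uL|Lu] := leP u L; last first.
  rewrite max_r //; split; rewrite ?L0 ?lexx //.
    move=> u0 L1 /andP[h1 h2].
    have nu := ler_norm (u - u0); have nL := normr_ge0 (L - L1).
    have nL' := ler_norm (- (L - L1)); have n0 := normr_ge0 (u - u0).
    rewrite normrN in nL'; have [h3|h3] := leP u0 L.
      rewrite ger0_norm ?subr_ge0 //; lra.
    rewrite ltr0_norm ?subr_lt0 //; lra.
  by case/andP.
have [u0|u0] := leP 0 u.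
  split; rewrite ?u0 ?uL // => u1 L1 _; by rewrite lerDl.
split; rewrite ?lexx ?L0 //.
  move=> u1 L1 /andP[h1 h2]; rewrite sub0r normrN ger0_norm //.
  by have := ler_norm (- (u - u1)); have := normr_ge0 (L - L1); rewrite normrN; lra.
Qed.

(** P is the periodic extension and Q the smooth function, equal to it on the strip only. Since L is
    Lipschitz at a, the distance from u to the strip is of first order in u - u0 and y - a, and the
    two derivatives in u share the limit T. *)
Lemma seam_expansion Y a (u0 : R) (P P1 Q Q1 : R -> R -> R) (L : R -> R) T B c :
  Y a -> 0 <= u0 <= L a -> (forall y, Y y -> 0 <= L y) ->
  (forall (u : R) y, Y y -> is_derive u 1 (P ^~ y) (P1 u y)) ->
  (forall (u : R) y, Y y -> is_derive u 1 (Q ^~ y) (Q1 u y)) ->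
  (forall u y, Y y -> 0 <= u <= L y -> P u y = Q u y) ->
  (forall e, 0 < e -> near2 Y u0 a (fun u y => `|P1 u y - T| <= e)) ->
  (forall e, 0 < e -> near2 Y u0 a (fun u y => `|Q1 u y - T| <= e)) ->
  is_derive_within Y (Q u0) a B ->
  0 < c -> near1 Y a (fun y => `|L y - L a| <= c * `|y - a|) ->
  forall e, 0 < e -> near2 Y u0 a (fun u y =>
    `|P u y - P u0 a - (u - u0) * T - (y - a) * B| <= e * (`|u - u0| + `|y - a|)).
Proof.
move=> Ya hu0 L0 hP hQ hPQ hP1 hQ1 hB c0 hL e e0.
(* The three errors below add up to at most e1 (3 |u - u0| + (1 + 2c) |y - a|). The same factor
   keeps the intermediate points within d of u0. *)
pose e1 := e / (8 * (1 + c)).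
have c1 : 0 < 8 * (1 + c) by lra.
have e10 : 0 < e1 by rewrite divr_gt0.
have ee : e1 * (8 * (1 + c)) = e by rewrite divfK // gt_eqF.
have /is_derive_withinP/(_ _ e10) n2 := hB.
have [d d0 hd] := near2_ex (near2I (near2I (hP1 e1 e10) (hQ1 e1 e10))
  (near2I (near1_near2 u0 n2) (near1_near2 u0 hL))).
have u00 : `|u0 - u0| < d by rewrite subrr normr0.
have d10 : 0 < d / (8 * (1 + c)) by rewrite divr_gt0.
rewrite /near2; near=> d' => u y ud yd Yy.
have {}yd0 : `|y - a| < d / (8 * (1 + c)) by apply: (lt_trans yd); near: d'; exact: nbhs_right_lt.
have {}ud0 : `|u - u0| < d / (8 * (1 + c)) by apply: (lt_trans ud); near: d'; exact: nbhs_right_lt.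
move: yd0 ud0; rewrite !ltr_pdivlMr // => yd0 ud0.
have n_y := normr_ge0 (y - a); have n_u := normr_ge0 (u - u0).
have cy : 0 <= c * `|y - a| by rewrite mulr_ge0 // ltW.
have cu : 0 <= c * `|u - u0| by rewrite mulr_ge0 // ltW.
have yd1 : `|y - a| < d by lra.
(* P is known only through its derivative outside [0, L y]: go from u to its
   projection v on [0, L y], then follow Q. *)
have [v [v1 v2 v3]] := clamp_spec u (L0 y Yy).
have vu0 := v2 _ _ hu0; have hLy := (hd u0 y u00 yd1 Yy).2.2.
have vd : `|v - u0| < d by lra.
have uv : `|u - v| <= 2 * `|u - u0| + c * `|y - a|.
  have := ler_normB (u - u0) (v - u0); rewrite opprB addrA subrK.
  by lra.
have E1 : `|P u y - P v y - (u - v) * T| <= e1 * `|u - v|.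
  apply: (mean_value_estimate (f := P ^~ y)) => [z|z hz]; first exact: hP.
  apply: (hd z y _ yd1 Yy).1.1.
  have := ler_normD (z - v) (v - u0); rewrite addrA subrK.
  by lra.
have E2 : `|Q v y - Q u0 y - (v - u0) * T| <= e1 * `|v - u0|.
  apply: (mean_value_estimate (f := Q ^~ y)) => [z|z hz]; first exact: hQ.
  by apply: (hd z y _ yd1 Yy).1.2; lra.
have E3 := (hd u0 y u00 yd1 Yy).2.1.
have -> : P u y - P u0 a - (u - u0) * T - (y - a) * B =
  (P u y - P v y - (u - v) * T) + (Q v y - Q u0 y - (v - u0) * T) +
  (Q u0 y - Q u0 a - (y - a) * B).
  by rewrite (hPQ v) // (hPQ u0) //; ring.
apply: (le_trans (ler_normD _ _)); apply: (le_trans (lerD (ler_normD _ _) (lexx _))).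
have m1 : e1 * `|u - v| <= e1 * (2 * `|u - u0| + c * `|y - a|) by rewrite ler_pM2l.
have m2 : e1 * `|v - u0| <= e1 * (`|u - u0| + c * `|y - a|) by rewrite ler_pM2l //; lra.
rewrite -ee.
have p1 : 0 <= e1 * `|u - u0| by rewrite mulr_ge0 // ltW.
have p2 : 0 <= e1 * `|y - a| by rewrite mulr_ge0 // ltW.
have p3 : 0 <= e1 * (c * `|u - u0|) by rewrite mulr_ge0 // ltW.
have p4 : 0 <= e1 * (c * `|y - a|) by rewrite mulr_ge0 // ltW.
lra.
Unshelve. all: by end_near. Qed.

End WithinCalculus.

(** * First order expansion of the parametrizations *)

Section DerivativeOnInterval.
Context {R : realType}.

(** At an end point the functions agree on one side only, but a one-sided limit of difference
    quotients already determines a two-sided derivative. *)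
Lemma is_derive_unique_on (V : normedModType R) (f g : R -> V) (L u : R) (l k : V) :
  0 < L -> 0 <= u <= L -> (forall t, 0 <= t <= L -> f t = g t) ->
  is_derive u 1 f l -> is_derive u 1 g k -> l = k.
Proof.
move=> L0 /andP[u0 uL] fg /is_derive1_cvg hf /is_derive1_cvg hg.
have fgu : f u = g u by apply: fg; rewrite u0.
have H (F : set_system R) : ProperFilter F ->
    h^-1 *: (f (h + u) - f u) @[h --> F] --> l ->
    h^-1 *: (g (h + u) - g u) @[h --> F] --> k ->
    (\forall h \near F, 0 <= h + u <= L) -> l = k.
  move=> FF hf' hg' hF.
  apply: (cvg_unique (@norm_hausdorff _ _) hf').
  apply: cvg_trans hg'; apply: near_eq_cvg.
  by apply: filterS hF => h hh; rewrite fg // fgu.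
have [uL'|uL'] := ltP u L.
  apply: (H _ _ (cvg_dnbhs_at_right hf) (cvg_dnbhs_at_right hg)).
  near=> h; apply/andP; split.
    by rewrite addr_ge0 //; near: h; exact: nbhs_right_ge.
  by rewrite -lerBrDr; near: h; apply: nbhs_right_le; rewrite subr_gt0.
apply: (H _ _ (cvg_dnbhs_at_left hf) (cvg_dnbhs_at_left hg)).
near=> h; apply/andP; split.
  rewrite -lerBlDr sub0r; near: h; apply: nbhs_left_ge; rewrite oppr_lt0; lra.
by rewrite (le_trans _ uL) // gerDr; near: h; exact: nbhs_left_le.
Unshelve. all: by end_near. Qed.

Lemma is_derive_within_dotl (Y : set R) (f : R -> plane R) x l z :
  is_derive_within Y f x l -> is_derive_within Y (fun t => dot (f t) z) x (dot l z).
Proof.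
rewrite /is_derive_within => h.
have c1 := cvg_comp _ _ h (@cvg_fst _ _ (nbhs l.1) (nbhs l.2) _).
have c2 := cvg_comp _ _ h (@cvg_snd _ _ (nbhs l.1) (nbhs l.2) _).
have -> : (fun y => (y - x)^-1 *: (dot (f y) z - dot (f x) z)) =
   (fun y => ((y - x)^-1 *: (f y - f x)).1 * z.1 + ((y - x)^-1 *: (f y - f x)).2 * z.2).
  by apply/funext => y; rewrite /dot /= /GRing.scale /=; ring.
apply: cvgD; apply: cvgM; [exact: c1|exact: cvg_cst|exact: c2|exact: cvg_cst].
Qed.

Lemma derive_gt0_right (f : R -> R) (x l : R) : is_derive x 1 f l -> 0 < l ->
  \forall h \near 0^'+, f x < f (h + x).
Proof.
move=> /is_derive1_cvg /cvg_dnbhs_at_right hf l0.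
have h1 := cvgr_gt l hf 0 l0.
near=> h; rewrite -subr_gt0.
have h0 : 0 < h by near: h; exact: nbhs_right_gt.
have : 0 < h^-1 *: (f (h + x) - f x) by near: h; exact: h1.
by rewrite /GRing.scale /= pmulr_rgt0 // invr_gt0.
Unshelve. all: by end_near. Qed.

Lemma gt0_near1 (x : R) : `|x - 1| < 2^-1 -> 0 < x.
Proof. by rewrite ltr_norml => /andP[]; lra. Qed.

(** The product form is the one that compactness as near covering consumes. *)
Lemma near2_prod (Y : set R) (u0 a : R) (A : R -> R -> Prop) : near2 Y u0 a A ->
  \forall u \near u0 & y \near within Y (nbhs a), A u y.
Proof.
move=> /near2_ex[d d0 hd].
exists (ball u0 d, [set y | Y y /\ `|y - a| < d]).
  split => /=; first exact: nbhsx_ballx.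
  apply/nbhs_ballP; exists d => //= y; rewrite /ball /= distrC => h Yy; by split.
move=> [u y] /= [h1 [h2 h3]]; apply: hd => //.
by move: h1; rewrite /ball /= distrC.
Qed.

End DerivativeOnInterval.

(** * The perimeter and the periodic extensions near the base parameter *)

Section Deformation.
Context {R : realType} {m r r' : nat} (Y : set R) (K : R -> table R m).
Hypotheses (hr : (2 <= r)%N) (hr' : (1 <= r')%N).
Hypothesis hT : forall y, Y y -> billiard_table (K y) r.
Hypothesis iY : is_interval Y.
Context (i : 'I_m) (D : nat -> nat -> R -> R -> plane R).
Hypothesis hD : mixed_partials Y r r' D.
Hypothesis hD0 : forall u y, Y y -> 0 <= u <= perim (K y) i ->
  param (K y) i u = D 0%N 0%N u y.
Context (a : R).
Hypothesis Ya : Y a.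

Local Notation L := (fun y => perim (K y) i).

Lemma perim_pos y : Y y -> 0 < perim (K y) i.
Proof. by move=> Yy; exact: (perim_gt0 (hT Yy)). Qed.

Lemma D_derive q q' (u : R) y : (q < 2)%N -> (q' <= 1)%N -> Y y ->
  is_derive u 1 (D q q' ^~ y) (D q.+1 q' u y).
Proof.
move=> h1 h2 Yy; have [h _ _] := hD; apply: h => //; first exact: leq_trans hr.
exact: leq_trans hr'.
Qed.

Lemma D_within u y : Y y -> is_derive_within Y (D 0%N 0%N u) y (D 0%N 1%N u y).
Proof. by move=> Yy; have [_ h _] := hD; apply: h. Qed.

Lemma D_cont q q' u0 z e : (q <= 2)%N -> (q' <= 1)%N -> 0 < e ->
  near2 Y u0 a (fun u y => `|dot (D q q' u y) z - dot (D q q' u0 a) z| < e).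
Proof.
move=> h1 h2; have [_ _ h] := hD.
have /subspace_continuousP/(_ (u0, a) Ya) /= {}h :=
  h q q' (leq_trans h1 hr) (leq_trans h2 hr').
apply: (@near2_cvg _ Y u0 a (fun u y => dot (D q q' u y) z)).
have c1 := cvg_comp _ _ h (@cvg_fst _ _ (nbhs (D q q' u0 a).1) (nbhs (D q q' u0 a).2) _).
have c2 := cvg_comp _ _ h (@cvg_snd _ _ (nbhs (D q q' u0 a).1) (nbhs (D q q' u0 a).2) _).
apply: cvgD; apply: cvgM; [exact: c1|exact: cvg_cst|exact: c2|exact: cvg_cst].
Qed.

Lemma tangentE y u : Y y -> 0 <= u <= perim (K y) i -> tangent (K y) i u = D 1%N 0%N u y.
Proof.
move=> Yy hu; apply: (is_derive_unique_on (perim_pos Yy) hu _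
  (is_derive_param hr (hT Yy) i u) (D_derive u _ _ Yy)) => // t ht.
exact: hD0.
Qed.

Lemma tangent2E_D y u : Y y -> 0 <= u <= perim (K y) i ->
  derive1n 2 (param (K y) i) u = D 2 0%N u y.
Proof.
move=> Yy hu; apply: (is_derive_unique_on (perim_pos Yy) hu _
  (is_derive_tangent hr (hT Yy) i u) (D_derive u _ _ Yy)) => // t ht.
exact: tangentE.
Qed.


Lemma tangent_per y u : Y y -> tangent (K y) i (u + perim (K y) i) = tangent (K y) i u.
Proof. by move=> Yy; exact: (tangent_periodic (hT Yy)). Qed.

Lemma D00_closed y : Y y -> D 0%N 0%N (L y) y = D 0%N 0%N 0 y.
Proof.
move=> Yy; have p := perim_pos Yy; rewrite -!hD0 ?lexx ?(ltW p) //.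
by have := param_periodic (hT Yy) i 0; rewrite add0r.
Qed.

(** The direction at the seam. Near both ends of the period the nearby curves advance along T0 at a
    rate above 1/2, which controls where they can close up. *)
Let T0 := tangent (K a) i 0.

Let D10_0 : D 1%N 0%N 0 a = T0.
Proof. by rewrite -tangentE // lexx ltW // perim_pos. Qed.

Let D10_L : D 1%N 0%N (L a) a = T0.
Proof.
transitivity (tangent (K a) i (perim (K a) i)).
  by rewrite tangentE // lexx ltW // perim_pos.
by have := tangent_per 0 Ya; rewrite add0r.
Qed.

Let T0_unit : dot T0 T0 = 1.
Proof. by rewrite -sqr_enorm (param_arclength (hT Ya)) expr1n. Qed.

Let near_T0 u : D 1%N 0%N u a = T0 ->
  near2 Y u a (fun u y => `|dot (D 1%N 0%N u y) T0 - 1| < 2^-1).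
Proof.
move=> e; have := @D_cont 1 0 u T0 2^-1 isT isT; rewrite e T0_unit; apply.
by rewrite invr_gt0.
Qed.

(** The curve for y closes up at u = L y. Each l in the compact interval [0, L a - e] is excluded as
    closing parameter, together with its neighbours and for all y near a. *)
Lemma perim_lower e : 0 < e -> near1 Y a (fun y => L a - e < L y).
Proof.
move=> e0; apply/near1P.
have /compact_near_coveringP cov := @segment_compact R 0 (L a - e).
have : \forall y \near within Y (nbhs a),
    `[0, L a - e]%classic `<=` [set l | Y y -> 0 < l -> L y <> l].
  apply: cov => l; rewrite /= in_itv /= => /andP[l0 lL]; apply: near2_prod.
  (* Near l = 0 the curve advances along T0 and cannot return so soon. For l > 0 the curve at y = a
     is injective, and the gap v between its points at l and 0 persists by continuity. *)
  have [l0'|l0'] := eqVneq l 0.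
    subst l; have [d d0 hd] := near2_ex (near_T0 D10_0).
    apply: (near2_intro d0) => l y; rewrite subr0 => ld yd _ Yy lpos Ly.
    have := @mean_value_estimate R (fun t => dot (D 0%N 0%N t y) T0)
      (fun t => dot (D 1%N 0%N t y) T0) 0 l 1 2^-1.
    rewrite -Ly D00_closed // subrr subr0 mulr1 sub0r normrN => h.
    have : `|L y| <= 2^-1 * `|L y|.
      apply: h => z; first exact/is_derive_dotl/D_derive.
      rewrite subr0 => hz; apply/ltW/hd => //.
      by rewrite subr0 (le_lt_trans hz) // Ly.
    rewrite gtr0_norm ?perim_pos //; have := perim_pos Yy; lra.
  have lpos : 0 < l by rewrite lt_neqAle eq_sym l0'.
  pose v := D 0%N 0%N l a - D 0%N 0%N 0 a.
  have v0 : 0 < dot v v.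
    rewrite -sqr_enorm exprn_gt0 // enorm_gt0 /v -!hD0 ?lexx ?ltW ?perim_pos //; last lra.
    rewrite subr_eq0; apply/eqP => ev; have := param_eq_lt_perim (hT Ya) (esym ev).
    rewrite subr0 gtr0_norm // => /(_ _)h; have := h _; lra.
  have v2 : 0 < dot v v / 2 by rewrite divr_gt0.
  have n1 := D_cont l v (isT : 0 <= 2)%N (isT : 0 <= 1)%N v2.
  have n2 := near2_slice (D_cont 0 v (isT : 0 <= 2)%N (isT : 0 <= 1)%N v2).
  apply: near2W (near2I n1 (near1_near2 l n2)) => u y [h1 h2] Yy u0 Ly.
  move: h1; rewrite -Ly D00_closed // => h1.
  have : dot v v = dot (D 0%N 0%N l a) v - dot (D 0%N 0%N 0 a) v by rewrite -dotBl.
  move: h1 h2; rewrite !ltr_norml => /andP[h1 h2] /andP[h3 h4]; lra.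
have hYy : \forall y \near within Y (nbhs a), Y y by exact: withinT.
apply: filterS2 hYy => y Yy /(_ (L y)) /= h; rewrite ltNge; apply/negP => hle.
by apply: h => //; [rewrite in_itv /= ltW // perim_pos|exact: perim_pos].
Qed.

Let D10_cvg u z : dot (D 1%N 0%N u y) z @[y --> within Y (nbhs a)] --> dot (D 1%N 0%N u a) z.
Proof.
apply/cvgrPdist_lt => e e0.
have /near1P := near2_slice (@D_cont 1 0 u z e isT isT e0).
by apply: filterS => y; rewrite distrC.
Qed.

Let D10_cross_cvg s t : cross (D 1%N 0%N s y) (D 1%N 0%N t y)
  @[y --> within Y (nbhs a)] --> cross (D 1%N 0%N s a) (D 1%N 0%N t a).
Proof.
have c1 u : (D 1%N 0%N u y).1 @[y --> within Y (nbhs a)] --> (D 1%N 0%N u a).1.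
  have E y : (D 1%N 0%N u y).1 = dot (D 1%N 0%N u y) (1, 0).
    by rewrite /dot /= mulr1 mulr0 addr0.
  by under eq_fun do rewrite E; rewrite E; exact: D10_cvg.
have c2 u : (D 1%N 0%N u y).2 @[y --> within Y (nbhs a)] --> (D 1%N 0%N u a).2.
  have E y : (D 1%N 0%N u y).2 = dot (D 1%N 0%N u y) (0, 1).
    by rewrite /dot /= mulr1 mulr0 add0r.
  by under eq_fun do rewrite E; rewrite E; exact: D10_cvg.
by apply: cvgB; apply: cvgM; [exact: c1|exact: c2|exact: c2|exact: c1].
Qed.

(* If the perimeter jumped up by e, the boundary curves for y near a would turn
   past their initial direction before closing up, hence have equal tangents at
   two distinct points; this contradicts strict convexity. *)
Lemma perim_upper e : 0 < e -> near1 Y a (fun y => L y < L a + e).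
Proof.
move=> e0; have La := perim_pos Ya; apply/near1P.
have [d1 d10 hd1] := near2_ex (near_T0 D10_0).
have [d2 d20 hd2] := near2_ex (near_T0 D10_L).
have curv u : D 1%N 0%N u a = T0 -> 0 <= u <= L a ->
    is_derive u 1 (fun s => cross T0 (D 1%N 0%N s a)) (curvature (K a) i u).
  move=> eu hu; rewrite /curvature tangentE // eu tangent2E_D //.
  exact/is_derive_crossr/D_derive.
have hu0 : 0 <= (0 : R) <= L a by apply/andP; split=> //; exact: ltW.
have huL : 0 <= L a <= L a by apply/andP; split=> //; exact: ltW.
have c0 := derive_gt0_right (curv 0 D10_0 hu0) (curvature_gt0 (hT Ya) i 0).
have cL := derive_gt0_right (curv (L a) D10_L huL) (curvature_gt0 (hT Ya) i (L a)).
rewrite D10_0 crossxx in c0; rewrite D10_L crossxx in cL.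
have [d [dpos [dd1 [dL]]]] := filter_ex (filterI (nbhs_right_gt 0)
  (filterI (nbhs_right_lt d10) (filterI (nbhs_right_lt La) c0))).
rewrite addr0 => hd; pose w := D 1%N 0%N d a.
have nw : \forall h \near (0 : R)^'+, cross w (D 1%N 0%N (h + L a) a) < 0.
  have dw : is_derive (L a) 1 (fun s => cross w (D 1%N 0%N s a))
      (cross w (D 2 0%N (L a) a)) by exact/is_derive_crossr/D_derive.
  have cw := is_derive_continuous dw; have neg : cross w (D 1%N 0%N (L a) a) < 0.
    by rewrite D10_L crossC oppr_lt0.
  have : \forall s \near L a, cross w (D 1%N 0%N s a) < 0.
    exact: (cvgr_lt _ cw 0 neg).
  move=> /nbhs_ballP[c /= cpos hc].
  near=> h; apply: hc; rewrite /ball /= opprD addrCA subrr addr0 normrN.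
  rewrite gtr0_norm; first by near: h; exact: nbhs_right_lt.
  by near: h; exact: nbhs_right_gt.
have [h [hpos [he [hd2' [hT0 hw]]]]] := filter_ex (filterI (nbhs_right_gt 0)
  (filterI (nbhs_right_lt e0) (filterI (nbhs_right_lt d20) (filterI cL nw)))).
(* The direction [D 1 0] at t lies strictly between T0 and w. Both inequalities persist for y near
   a, and if L y >= L a + e then t is a genuine parameter of the boundary curve for y. *)
pose t := h + L a.
have p0 : 0 < cross (D 1%N 0%N 0 a) (D 1%N 0%N t a) by rewrite D10_0.
have n1 := cvgr_gt _ (@D10_cross_cvg 0 t) 0 p0.
have n2 := cvgr_lt _ (@D10_cross_cvg d t) 0 hw.
have n3 : \forall y \near within Y (nbhs a), `|y - a| < d1 by exact/near1P/near1_ball.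
have n4 : \forall y \near within Y (nbhs a), `|y - a| < d2 by exact/near1P/near1_ball.
have n5 : \forall y \near within Y (nbhs a), Y y by exact: withinT.
near=> y; rewrite ltNge; apply/negP => hLy.
have Yy : Y y by near: y; exact: n5.
pose g s := cross (D 1%N 0%N t y) (D 1%N 0%N s y).
have gc : continuous g.
  move=> s; apply: is_derive_continuous.
  exact/is_derive_crossr/(D_derive s (isT : 1 < 2)%N (isT : 0 <= 1)%N Yy).
have g0 : g 0 < 0 by rewrite /g crossC oppr_lt0; near: y; exact: n1.
have gd : 0 < g d by rewrite /g crossC oppr_gt0; near: y; exact: n2.
(* Between 0 and d the direction crosses that at t, so some s there has a tangent parallel to the
   one at t; both have a positive component along T0, hence they are equal. *)
have [|s] := @IVT R g 0 d 0 (ltW dpos) (continuous_subspaceT gc).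
  by rewrite ge_min le_max (ltW g0) (ltW gd) orbT.
rewrite in_itv /= => /andP[s0 sd] gs.
have tL : t < L y by apply: lt_le_trans hLy; rewrite /t addrC ltrD2l.
have st : s < t.
  by apply: (le_lt_trans sd); apply: (lt_trans dL); rewrite /t ltrDr.
have hs : 0 <= s <= L y by rewrite s0 ltW // (lt_trans st).
have ht : 0 <= t <= L y by rewrite (ltW tL) (le_trans s0) // ltW.
have es := tangentE Yy hs; have et := tangentE Yy ht.
have us := param_arclength (hT Yy) i s; have ut := param_arclength (hT Yy) i t.
have ds : `|dot (D 1%N 0%N s y) T0 - 1| < 2^-1.
  apply: hd1 => //; last by near: y; exact: n3.
  by rewrite subr0 ger0_norm // (le_lt_trans sd).
have dt : `|dot (D 1%N 0%N t y) T0 - 1| < 2^-1.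
  apply: hd2 => //; last by near: y; exact: n4.
  by rewrite /t addrK gtr0_norm.
have e1 : tangent (K y) i s = tangent (K y) i t.
  apply/esym/unit_cross0 => //; first by rewrite es et.
  move: gs; rewrite /g -es -et => /(cross0_parallel ut) E.
  have ds0 : 0 < dot (tangent (K y) i s) T0 by rewrite es; exact: gt0_near1 ds.
  have dt0 : 0 < dot (tangent (K y) i t) T0 by rewrite et; exact: gt0_near1 dt.
  have E2 := dotZl (dot (tangent (K y) i s) (tangent (K y) i t)) (tangent (K y) i t) T0.
  rewrite -E in E2; rewrite dotC -(pmulr_lgt0 _ dt0) -E2; exact: ds0.
have ne : param (K y) i t != param (K y) i s.
  apply/eqP => /esym E; have := param_eq_lt_perim (hT Yy) E.
  have ts : t - s < L y by apply: le_lt_trans tL; rewrite gerBl.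
  rewrite gtr0_norm ?subr_gt0 // => /(_ ts) e2; by rewrite e2 ltxx in st.
(* Each of the two points would lie strictly to the left of the other one's tangent line, although
   the two tangents are equal. *)
have h1 := chord_left (hT Yy) (param_body (hT Yy) i t) ne.
rewrite eq_sym in ne.
have h2 := chord_left (hT Yy) (param_body (hT Yy) i s) ne.
move: h1; rewrite e1 -opprB crossNr oppr_gt0 => h1.
by rewrite ltNge (ltW h1) in h2.
Unshelve. all: by end_near. Qed.

Lemma perim_near e : 0 < e -> near1 Y a (fun y => `|L y - L a| < e).
Proof.
move=> e0; have [d1 d10 h1] := near1_ex (perim_lower e0).
have [d2 d20 h2] := near1_ex (perim_upper e0).
rewrite /near1; near=> d => y yd Yy.
have y1 := h1 y (lt_trans yd _) Yy; have y2 := h2 y (lt_trans yd _) Yy.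
have {}y1 : L a - e < L y by apply: y1; near: d; exact: nbhs_right_lt.
have {}y2 : L y < L a + e by apply: y2; near: d; exact: nbhs_right_lt.
by rewrite ltr_norml; apply/andP; split; lra.
Unshelve. all: by end_near. Qed.

(** Project the closing condition at u = L y on T0. The two ends, at u = 0 and u = L a, separate by
    O(|y - a|), and the slope along T0 bounds the parameter needed to make up for it. *)
Lemma perim_lipschitz : exists2 c, 0 < c &
  near1 Y a (fun y => `|L y - L a| <= c * `|y - a|).
Proof.
have [d d0 hd] := near2_ex (near_T0 D10_L).
pose B0 := dot (D 0%N 1%N 0 a) T0; pose BL := dot (D 0%N 1%N (L a) a) T0.
have /is_derive_withinP/(_ _ ltr01) n0 := is_derive_within_dotl (z := T0) (@D_within 0 a Ya).
have /is_derive_withinP/(_ _ ltr01) nL := is_derive_within_dotl (z := T0) (@D_within (L a) a Ya).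
have n := near1I (perim_near d0) (near1I (near1_ball Y a d0) (near1I n0 nL)).
(* The factor 2 inverts the slope 1/2; B0 and BL are the speeds of the two ends along T0, each
   expanded with error 1. *)
exists (2 * (2 + `|B0| + `|BL|)).
  by have := normr_ge0 B0; have := normr_ge0 BL; lra.
have [c c0 hc] := near1_ex n; rewrite /near1; near=> c' => y yc Yy.
have [h1 [h2 [h3 h4]]] : `|L y - L a| < d /\ `|y - a| < d /\
    `|dot (D 0%N 0%N 0 y) T0 - dot (D 0%N 0%N 0 a) T0 - (y - a) * B0| <= 1 * `|y - a| /\
    `|dot (D 0%N 0%N (L a) y) T0 - dot (D 0%N 0%N (L a) a) T0 - (y - a) * BL|
      <= 1 * `|y - a|.
  by apply: hc => //; apply: (lt_trans yc); near: c'; exact: nbhs_right_lt.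
have := @mean_value_estimate R (fun t => dot (D 0%N 0%N t y) T0)
  (fun t => dot (D 1%N 0%N t y) T0) (L a) (L y) 1 2^-1.
rewrite mulr1 D00_closed // => h5.
have {}h5 : `|dot (D 0%N 0%N 0 y) T0 - dot (D 0%N 0%N (L a) y) T0 - (L y - L a)| <=
    2^-1 * `|L y - L a|.
  apply: h5 => z; first exact/is_derive_dotl/D_derive.
  by move=> hz; apply/ltW/hd => //; exact: le_lt_trans hz h1.
rewrite D00_closed // in h4.
have e1 : `|(y - a) * B0| = `|B0| * `|y - a| by rewrite normrM mulrC.
have e2 : `|(y - a) * BL| = `|BL| * `|y - a| by rewrite normrM mulrC.
set q := dot (D 0%N 0%N 0 a) T0 in h3 h4.
set q0 := dot (D 0%N 0%N 0 y) T0 in h3 h5; set qL := dot (D 0%N 0%N (L a) y) T0 in h4 h5.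
have t1 := ler_normB (q0 - q - (y - a) * B0) (qL - q - (y - a) * BL).
have t2 := ler_normB (q0 - q - (y - a) * B0 - (qL - q - (y - a) * BL))
   (q0 - qL - (L y - L a)).
have t3 := ler_normB ((y - a) * BL) ((y - a) * B0).
have t4 := ler_normB (q0 - q - (y - a) * B0 - (qL - q - (y - a) * BL)
   - (q0 - qL - (L y - L a))) ((y - a) * BL - (y - a) * B0).
have E : q0 - q - (y - a) * B0 - (qL - q - (y - a) * BL)
   - (q0 - qL - (L y - L a)) - ((y - a) * BL - (y - a) * B0) = L y - L a by ring.
rewrite E in t4; have := mulr_ge0 (normr_ge0 B0) (normr_ge0 (y - a)); nra.
Unshelve. all: by end_near. Qed.

(** Vectors are tested against a fixed z because the mean value theorem is scalar. *)
Lemma param_expansion u0 z e : 0 <= u0 <= L a -> 0 < e -> near2 Y u0 a (fun u y =>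
  `|dot (param (K y) i u) z - dot (param (K a) i u0) z
    - (u - u0) * dot (D 1%N 0%N u0 a) z - (y - a) * dot (D 0%N 1%N u0 a) z|
  <= e * (`|u - u0| + `|y - a|)).
Proof.
move=> hu0; have [c c0 hc] := perim_lipschitz.
apply: (@seam_expansion R Y a u0 (fun u y => dot (param (K y) i u) z)
  (fun u y => dot (tangent (K y) i u) z) (fun u y => dot (D 0%N 0%N u y) z)
  (fun u y => dot (D 1%N 0%N u y) z) L _ _ c) => //.
- by move=> y Yy; rewrite ltW // perim_pos.
- by move=> u y Yy; exact/is_derive_dotl/(is_derive_param hr (hT Yy)).
- by move=> u y Yy; exact/is_derive_dotl/D_derive.
- by move=> u y Yy hu; rewrite hD0.
- apply: (@seam_continuity R Y a (fun u y => dot (tangent (K y) i u) z)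
    (fun u y => dot (D 1%N 0%N u y) z) L u0 Ya hu0 perim_pos perim_near).
  + by move=> u y Yy; rewrite tangent_per.
  + by move=> u y Yy hu; rewrite tangentE.
  + by move=> u1 e1; exact: D_cont.
- move=> e1 e10; apply: near2W (@D_cont 1 0 u0 z e1 isT isT e10) => u y.
  exact: ltW.
- exact/is_derive_within_dotl/D_within.
Qed.

Lemma tangent_expansion u0 z e : 0 <= u0 <= L a -> 0 < e -> near2 Y u0 a (fun u y =>
  `|dot (tangent (K y) i u) z - dot (tangent (K a) i u0) z
    - (u - u0) * dot (D 2 0%N u0 a) z - (y - a) * dot (D 1%N 1%N u0 a) z|
  <= e * (`|u - u0| + `|y - a|)).
Proof.
move=> hu0; have [c c0 hc] := perim_lipschitz.
apply: (@seam_expansion R Y a u0 (fun u y => dot (tangent (K y) i u) z)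
  (fun u y => dot (derive1n 2 (param (K y) i) u) z) (fun u y => dot (D 1%N 0%N u y) z)
  (fun u y => dot (D 2 0%N u y) z) L _ _ c) => //.
- by move=> y Yy; rewrite ltW // perim_pos.
- by move=> u y Yy; exact/is_derive_dotl/(is_derive_tangent hr (hT Yy)).
- by move=> u y Yy; exact/is_derive_dotl/D_derive.
- by move=> u y Yy hu; rewrite tangentE.
- apply: (@seam_continuity R Y a (fun u y => dot (derive1n 2 (param (K y) i) u) z)
    (fun u y => dot (D 2 0%N u y) z) L u0 Ya hu0 perim_pos perim_near).
  + by move=> u y Yy; rewrite (tangent2_periodic (hT Yy)).
  + by move=> u y Yy hu; rewrite tangent2E_D.
  + by move=> u1 e1; exact: D_cont.
- move=> e1 e10; apply: near2W (@D_cont 2 0 u0 z e1 isT isT e10) => u y.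
  exact: ltW.
(* [mixed_partials] differentiates in y only at order 0 in u, so the y-derivative of the tangent
   requires exchanging the order of differentiation. *)
- apply: (@mixed_derive R Y a u0 (fun u y => dot (D 0%N 0%N u y) z)
    (fun u y => dot (D 1%N 0%N u y) z) (fun u y => dot (D 0%N 1%N u y) z)
    (fun u y => dot (D 1%N 1%N u y) z)) => //.
  + by move=> u y Yy; exact/is_derive_dotl/D_derive.
  + by move=> u y Yy; exact/is_derive_within_dotl/D_within.
  + by move=> u y Yy; exact/is_derive_dotl/D_derive.
  + by move=> e1; exact: D_cont.
Qed.

End Deformation.

(** * Slopes and linear systems *)

Section LinearLimits.
Context {R : realType} (F : set_system R) {FF : ProperFilter F}.

Lemma cvg_sum_ord (I : finType) (f : I -> R -> R) (l : I -> R) :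
  (forall i, f i y @[y --> F] --> l i) ->
  \sum_i f i y @[y --> F] --> \sum_i l i.
Proof.
by move=> h; apply: cvg_big => [|i _]; [exact: add_continuous|exact: h].
Qed.

Lemma cvg_prod_ord (I : finType) (f : I -> R -> R) (l : I -> R) :
  (forall i, f i y @[y --> F] --> l i) ->
  \prod_i f i y @[y --> F] --> \prod_i l i.
Proof.
by move=> h; apply: cvg_big => [|i _]; [exact: mul_continuous|exact: h].
Qed.

Lemma cvg_det n (M : R -> 'M[R]_n) (M0 : 'M[R]_n) :
  (forall i j, M y i j @[y --> F] --> M0 i j) -> \det (M y) @[y --> F] --> \det M0.
Proof.
move=> h; rewrite /determinant; apply: cvg_sum_ord => s.
by apply: cvgM; [exact: cvg_cst|apply: cvg_prod_ord => i; exact: h].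
Qed.

Lemma cvg_adj n (M : R -> 'M[R]_n) (M0 : 'M[R]_n) :
  (forall i j, M y i j @[y --> F] --> M0 i j) ->
  forall i j, (\adj (M y)) i j @[y --> F] --> (\adj M0) i j.
Proof.
move=> h i j; under eq_fun do rewrite mxE; rewrite mxE /cofactor.
apply: cvgM; first exact: cvg_cst.
apply: cvg_det => k l; under eq_fun do rewrite !mxE; rewrite !mxE; exact: h.
Qed.

(* Cramer's rule expresses the quotients [d k y / s y] through entries that
   converge. *)
Lemma linear_system_limit n (A : R -> 'I_n -> 'I_n -> R) (A0 : 'I_n -> 'I_n -> R)
    (b : R -> 'I_n -> R) (b0 : 'I_n -> R) (d : 'I_n -> R -> R) (s : R -> R) :
  (forall j k, A y j k @[y --> F] --> A0 j k) ->
  (forall j, b y j @[y --> F] --> b0 j) ->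
  (\forall y \near F, s y != 0) ->
  (\forall y \near F, forall j, \sum_k A y j k * d k y + b y j * s y = 0) ->
  (forall v, (forall j, \sum_k A0 j k * v k = 0) -> forall k, v k = 0) ->
  exists2 v, (forall k, (s y)^-1 * d k y @[y --> F] --> v k) &
             forall j, \sum_k A0 j k * v k + b0 j = 0.
Proof.
move=> hA hb hs hsys inj.
pose M y : 'M[R]_n := \matrix_(j, k) A y j k.
pose M0 : 'M[R]_n := \matrix_(j, k) A0 j k.
have hM j k : M y j k @[y --> F] --> M0 j k.
  by under eq_fun do rewrite mxE; rewrite mxE; exact: hA.
(* A singular matrix has a nonzero vector in its kernel; [det0P] gives a row vector, hence the
   transpose. *)
have det0 : \det M0 != 0.
  rewrite -det_tr; apply/negP => /det0P[v vne hv]; move/eqP: vne; apply.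
  apply/rowP => k; rewrite [RHS]mxE; apply: (inj (fun k => v 0 k)) => j.
  transitivity ((v *m M0^T) 0 j); last by rewrite hv mxE.
  by rewrite mxE; apply: eq_bigr => l _; rewrite !mxE mulrC.
pose v k := - (\sum_j (\adj M0) k j * b0 j) / \det M0.
have hdet := cvg_det hM.
have hv k : (s y)^-1 * d k y @[y --> F] --> v k.
  have hw : - (\sum_j (\adj (M y)) k j * b y j) / \det (M y) @[y --> F] --> v k.
    apply: cvgM; last exact: (cvgV det0 hdet).
    apply: cvgN; apply: cvg_sum_ord => j; apply: cvgM; last exact: hb.
    exact: cvg_adj.
  apply: cvg_trans hw; apply: near_eq_cvg.
  have nz : \forall y \near F, \det (M y) != 0 by exact: (cvgr_neq0 _ hdet det0).
  near=> y.
  have s0 : s y != 0 by near: y.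
  have m0 : \det (M y) != 0 by near: y.
  have sys : forall j, \sum_k A y j k * d k y + b y j * s y = 0 by near: y.
  pose dv : 'cV[R]_n := \col_k d k y; pose bv : 'cV[R]_n := \col_j b y j.
  have e1 : M y *m dv = - s y *: bv.
    apply/colP => j; rewrite !mxE; apply/eqP; rewrite mulNr -addr_eq0 [s y * _]mulrC.
    rewrite -[X in _ == X](sys j); apply/eqP; congr (_ + _).
    by apply: eq_bigr => l _; rewrite !mxE.
  have e2 : \det (M y) * d k y = - s y * \sum_j (\adj (M y)) k j * b y j.
    have := congr1 (fun w : 'cV_n => (\adj (M y) *m w) k 0) e1.
    rewrite mulmxA mul_adj_mx mul_scalar_mx -scalemxAr !mxE => ->.
    by congr (_ * _); apply: eq_bigr => l _; rewrite !mxE.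
  apply: (mulfI m0); rewrite [RHS]mulrCA e2; field.
  by rewrite m0 s0.
exists v => // j.
have c1 : \sum_k A y j k * ((s y)^-1 * d k y) + b y j @[y --> F] -->
    \sum_k A0 j k * v k + b0 j.
  apply: cvgD; last exact: hb.
  by apply: cvg_sum_ord => k; apply: cvgM; [exact: hA|exact: hv].
have c2 : \sum_k A y j k * ((s y)^-1 * d k y) + b y j @[y --> F] --> (0 : R).
  apply: (@cvg_trans _ (cst 0 @ F)); last exact: cvg_cst.
  apply: near_eq_cvg; near=> y.
  have s0 : s y != 0 by near: y.
  have sys : forall j, \sum_k A y j k * d k y + b y j * s y = 0 by near: y.
  have -> // : \sum_k A y j k * ((s y)^-1 * d k y) + b y j = 0.
  apply: (mulIf s0); rewrite mul0r mulrDl mulr_suml -[RHS](sys j); congr (_ + _).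
    by apply: eq_bigr => k _; field.
exact: (cvg_unique (@norm_hausdorff _ R^o) c1 c2).
Unshelve. all: by end_near. Qed.

End LinearLimits.

(** * Calculus of slopes *)

Section Slopes.
Context {R : realType} (F : set_system R) {FF : ProperFilter F}.
Context {I : finType} (d : I -> R -> R).
Hypothesis d_cvg0 : forall i, d i y @[y --> F] --> (0 : R).

(* A Caratheodory form of "[f] is differentiable at the limit of F, with
   derivatives c with respect to the increments d". *)
Definition has_slopes (f : R -> R) (f0 : R) (c : I -> R) : Prop :=
  exists A : I -> R -> R, (forall i, A i y @[y --> F] --> c i) /\
    \forall y \near F, f y - f0 = \sum_i A i y * d i y.

Lemma slopes_cvg f f0 c : has_slopes f f0 c -> f y @[y --> F] --> f0.
Proof.
move=> [A [hA hf]].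
have h : f0 + \sum_i A i y * d i y @[y --> F] --> f0 + \sum_(i : I) c i * 0.
  apply: cvgD; first exact: cvg_cst.
  by apply: cvg_sum_ord => i; apply: cvgM.
rewrite big1 ?addr0 in h; last by move=> i _; rewrite mulr0.
apply: cvg_trans h; apply: near_eq_cvg; apply: filterS hf => y <-.
by rewrite addrC subrK.
Qed.

Lemma slopes_cst k : has_slopes (fun=> k) k (fun=> 0).
Proof.
exists (fun _ _ => 0); split=> [i|]; first exact: cvg_cst.
by apply: nearW => y; rewrite subrr big1 // => i _; rewrite mul0r.
Qed.

Lemma slopesD f g f0 g0 c e : has_slopes f f0 c -> has_slopes g g0 e ->
  has_slopes (fun y => f y + g y) (f0 + g0) (fun i => c i + e i).
Proof.
move=> [A [hA hf]] [B [hB hg]]; exists (fun i y => A i y + B i y); split.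
  by move=> i; exact: cvgD.
apply: filterS2 hf hg => y h1 h2; rewrite opprD addrACA h1 h2 -big_split.
by apply: eq_bigr => i _; rewrite mulrDl.
Qed.

Lemma slopesM f g f0 g0 c e : has_slopes f f0 c -> has_slopes g g0 e ->
  has_slopes (fun y => f y * g y) (f0 * g0) (fun i => c i * g0 + f0 * e i).
Proof.
move=> sf [B [hB hg]]; have cf := slopes_cvg sf; case: sf => A [hA hf].
exists (fun i y => A i y * g0 + f y * B i y); split.
  by move=> i; apply: cvgD; apply: cvgM => //; exact: cvg_cst.
apply: filterS2 hf hg => y h1 h2.
have -> : f y * g y - f0 * g0 = (f y - f0) * g0 + f y * (g y - g0) by ring.
rewrite h1 h2 mulr_suml mulr_sumr -big_split.
by apply: eq_bigr => i _ /=; ring.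
Qed.

Lemma slopesZ k f f0 c : has_slopes f f0 c ->
  has_slopes (fun y => k * f y) (k * f0) (fun i => k * c i).
Proof.
move=> h; have := slopesM (slopes_cst k) h.
by congr has_slopes; apply/funext => i; rewrite mul0r add0r.
Qed.

Lemma slopesB f g f0 g0 c e : has_slopes f f0 c -> has_slopes g g0 e ->
  has_slopes (fun y => f y - g y) (f0 - g0) (fun i => c i - e i).
Proof.
move=> hf hg; have := slopesD hf (slopesZ (-1) hg).
by congr has_slopes; [apply/funext => y|..|apply/funext => y]; rewrite mulN1r.
Qed.

Lemma slopesV f f0 c : f0 != 0 -> has_slopes f f0 c ->
  has_slopes (fun y => (f y)^-1) f0^-1 (fun i => - c i / (f0 * f0)).
Proof.
move=> n0 sf; have cf := slopes_cvg sf; case: sf => A [hA hf].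
exists (fun i y => - A i y / (f y * f0)); split.
  move=> i; apply: cvgM; first exact: cvgN.
  apply: (@cvgV _ _ _ _ (fun y => f y * f0)); first by rewrite mulf_neq0.
  by apply: cvgM => //; exact: cvg_cst.
have nz : \forall y \near F, f y != 0 by exact: (cvgr_neq0 _ cf n0).
apply: filterS2 nz hf => y fy h.
have -> : (f y)^-1 - f0^-1 = (f y - f0) * (- (f y * f0)^-1) by field; rewrite n0 fy.
by rewrite h mulr_suml; apply: eq_bigr => i _; ring.
Qed.

Lemma slopes_sqrt f f0 c : 0 < f0 -> has_slopes f f0 c ->
  has_slopes (fun y => Num.sqrt (f y)) (Num.sqrt f0) (fun i => c i / (2 * Num.sqrt f0)).
Proof.
move=> p0 sf; have cf := slopes_cvg sf; case: sf => A [hA hf].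
have s0 : 0 < Num.sqrt f0 by rewrite sqrtr_gt0.
have cs : Num.sqrt (f y) @[y --> F] --> Num.sqrt f0.
  by apply: (cvg_comp _ _ cf); exact: sqrt_continuous.
exists (fun i y => A i y / (Num.sqrt (f y) + Num.sqrt f0)); split.
  move=> i; apply: cvgM => //.
  apply: (@cvgV _ _ _ _ (fun y => Num.sqrt (f y) + Num.sqrt f0)).
    by rewrite gt_eqF // mulr_gt0.
  by rewrite mulr_natl mulr2n; apply: cvgD => //; exact: cvg_cst.
have nz : \forall y \near F, 0 < f y by exact: (cvgr_gt _ cf 0 p0).
apply: filterS2 nz hf => y fy h.
have sy : 0 < Num.sqrt (f y) by rewrite sqrtr_gt0.
have ne : Num.sqrt (f y) + Num.sqrt f0 != 0 by rewrite gt_eqF // addr_gt0.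
apply: (mulIf ne).
have -> : (Num.sqrt (f y) - Num.sqrt f0) * (Num.sqrt (f y) + Num.sqrt f0) = f y - f0.
  by rewrite -subr_sqr !sqr_sqrtr // ltW.
by rewrite h mulr_suml; apply: eq_bigr => i _; rewrite mulrAC divfK.
Qed.

(** The remainder r is shared among the increments: adding sg(d_i) r / S to the i-th coefficient,
    with S the sum of the |d_i|, restores exactly r, and r / S tends to 0. *)
Lemma slopes_of_expansion f f0 c :
  (forall e, 0 < e -> \forall y \near F,
     `|f y - f0 - \sum_i c i * d i y| <= e * \sum_i `|d i y|) ->
  has_slopes f f0 c.
Proof.
move=> h; pose r y := f y - f0 - \sum_i c i * d i y.
pose S y := \sum_i `|d i y|.
exists (fun i y => c i + Num.sg (d i y) * (r y / S y)); split.
  move=> i; rewrite -[X in _ --> X]addr0; apply: cvgD; first exact: cvg_cst.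
  apply/cvgrPdist_le => e e0; apply: filterS (h e e0) => y hy.
  rewrite sub0r normrN normrM -[leRHS]mul1r ler_pM ?normr_ge0 //.
    by rewrite normr_sg; case: (_ == _).
  have [->|ne] := eqVneq (S y) 0; first by rewrite invr0 mulr0 normr0 ltW.
  have S0 : 0 < S y by rewrite lt_neqAle eq_sym ne sumr_ge0.
  by rewrite normrM normfV (gtr0_norm S0) ler_pdivrMr.
apply: filterS (h 1 ltr01) => y hy.
have -> : \sum_i (c i + Num.sg (d i y) * (r y / S y)) * d i y =
    \sum_i c i * d i y + (r y / S y) * S y.
  rewrite /S mulr_sumr -big_split; apply: eq_bigr => i _ /=.
  by rewrite mulrDl normrEsg; ring.
(* If all increments vanish, the expansion itself forces f y = f0. *)
have [e|ne] := eqVneq (S y) 0; last by rewrite divfK // /r [RHS]addrC subrK.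
rewrite e mulr0 addr0; apply/eqP; rewrite -subr_eq0 -normr_le0.
by apply: le_trans hy _; rewrite -/(S y) e mulr0.
Qed.

End Slopes.

Section MaximumPrinciple.
Context {R : realType} {n : nat}.

(* Evaluate the equation where `|x| is maximal. *)
Lemma maximum_principle (x E c kap gp gs : 'I_n -> R) (p s : 'I_n -> 'I_n) (k B : R) :
  0 < k -> (forall j, k <= kap j) -> (forall j, 0 < c j <= 1) ->
  (forall j, 0 < gp j) -> (forall j, 0 < gs j) -> (forall j, `|E j| <= B) ->
  (forall j, 2 * kap j * (x j / c j) + (x j + x (p j)) / gp j +
             (x j + x (s j)) / gs j = E j) ->
  forall j, `|x j| <= B / (2 * k).
Proof.
move=> k0 hk hc hp hs hE heq j.
have [jm _ hmax] := @Order.TotalTheory.arg_maxP _ R _ j xpredT (fun i => `|x i|) isT.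
apply: (le_trans (hmax j isT)); rewrite ler_pdivlMr ?mulr_gt0 // mulrC.
have /andP[c0 c1] := hc jm; have := hE jm; have := heq jm.
have mp : `|x (p jm)| <= `|x jm| by exact: hmax.
have ms : `|x (s jm)| <= `|x jm| by exact: hmax.
have cx : k * `|x jm| <= kap jm * (`|x jm| / c jm).
  apply: ler_pM => //; first exact: ltW.
  by rewrite ler_pdivlMr // ler_piMr.
have gp0 := hp jm; have gs0 := hs jm.
move: mp ms cx; have [x0|x0] := leP 0 (x jm).
  rewrite (ger0_norm x0) !ler_norml => /andP[p1 p2] /andP[s1 s2] cx eqE.
  have q1 : 0 <= (x jm + x (p jm)) / gp jm by rewrite divr_ge0 ?(ltW gp0) //; lra.
  have q2 : 0 <= (x jm + x (s jm)) / gs jm by rewrite divr_ge0 ?(ltW gs0) //; lra.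
  move=> /andP[_ eB]; lra.
rewrite (ltr0_norm x0) !ler_norml => /andP[p1 p2] /andP[s1 s2] cx eqE.
have q1 : 0 <= (- x jm - x (p jm)) / gp jm by rewrite divr_ge0 ?(ltW gp0) //; lra.
have q2 : 0 <= (- x jm - x (s jm)) / gs jm by rewrite divr_ge0 ?(ltW gs0) //; lra.
move=> /andP[eB _]; lra.
Qed.

End MaximumPrinciple.

(** * Slopes of vectors and of unit directions *)

Section VectorSlopes.
Context {R : realType} (F : set_system R) {FF : ProperFilter F}.
Context {I : finType} (d : I -> R -> R).
Hypothesis d_cvg0 : forall i, d i y @[y --> F] --> (0 : R).

Definition vector_slopes (f : R -> plane R) (f0 : plane R) (c : I -> plane R) : Prop :=
  has_slopes F d (fun y => (f y).1) f0.1 (fun i => (c i).1) /\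
  has_slopes F d (fun y => (f y).2) f0.2 (fun i => (c i).2).

Lemma vector_slopesB f g f0 g0 c e : vector_slopes f f0 c -> vector_slopes g g0 e ->
  vector_slopes (fun y => f y - g y) (f0 - g0) (fun i => c i - e i).
Proof. by move=> [f1 f2] [g1 g2]; split; apply: slopesB. Qed.

(** When g0 moves by e, its direction v turns at the rate cross v e / |g0|; pairing the quarter turn
    of v with f0 gives cross v f0. *)
Lemma slopes_dot_direction f g f0 g0 c e : g0 != 0 ->
  vector_slopes f f0 c -> vector_slopes g g0 e ->
  has_slopes F d (fun y => dot (f y) (direction (g y))) (dot f0 (direction g0))
    (fun i => dot (c i) (direction g0) +
              cross (direction g0) f0 * cross (direction g0) (e i) / enorm g0).
Proof.
move=> n0 [f1 f2] [g1 g2].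
have N0 : 0 < enorm g0 by rewrite enorm_gt0.
have p0 : 0 < g0.1 * g0.1 + g0.2 * g0.2.
  by have := sqr_enorm g0; rewrite /dot => <-; rewrite exprn_gt0.
pose proof (slopesD (slopesM d_cvg0 g1 g1) (slopesM d_cvg0 g2 g2)) as sq.
pose proof (slopes_sqrt d_cvg0 p0 sq) as sN.
have nN : Num.sqrt (g0.1 * g0.1 + g0.2 * g0.2) != 0 by rewrite gt_eqF // sqrtr_gt0.
pose proof (slopesM d_cvg0 (slopesD (slopesM d_cvg0 f1 g1) (slopesM d_cvg0 f2 g2))
  (slopesV d_cvg0 nN sN)) as H.
have E x y : dot x (direction y) = dot x y * (enorm y)^-1.
  by rewrite /direction dotZr mulrC.
have -> : (fun y => dot (f y) (direction (g y))) = (fun y => dot (f y) (g y) * (enorm (g y))^-1).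
  by apply/funext => y; rewrite E.
rewrite E; move: H; congr has_slopes; apply/funext => i.
rewrite -/(enorm g0) -/(dot g0 g0) -/(enorm g0).
have := directionK g0; set N := enorm g0 in N0 *; set v := direction g0 => gE.
have vv : v.1 * v.1 + v.2 * v.2 = 1.
  by have := sqr_enorm v; rewrite enorm_direction // expr1n.
have g1E : g0.1 = N * v.1 by rewrite -{1}gE.
have g2E : g0.2 = N * v.2 by rewrite -{1}gE.
rewrite /dot /cross g1E g2E; move: N0 vv; case: (v) => v1 v2 /=.
case: (c i) => c1 c2; case: (e i) => e1 e2; case: f0 {f1 f2} => t1 t2 /= N0 vv.
have -> : (v1 * t2 - v2 * t1) * (v1 * e2 - v2 * e1) =
   (v1 * v1 + v2 * v2) * (t1 * e1 + t2 * e2) - (v1 * t1 + v2 * t2) * (v1 * e1 + v2 * e2).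
  by ring.
rewrite vv; field; by rewrite gt_eqF.
Qed.

End VectorSlopes.

Section IncrementSlopes.
Context {R : realType} (F : set_system R) {FF : ProperFilter F} {n : nat}.
Context (d : ('I_n + 'I_1)%type -> R -> R).

(** [inl l] stands for the l-th parameter of the orbit and [inr] for the deformation parameter. *)
Definition increment_coef (k : 'I_n) (T B : plane R) (i : 'I_n + 'I_1) : plane R :=
  match i with inl l => (l == k)%:R *: T | inr _ => B end.

Lemma sum_delta (f : 'I_n -> R) k : \sum_l (l == k)%:R * f l = f k.
Proof.
rewrite (bigD1 k) //= eqxx mul1r big1 ?addr0 // => l /negPf ->; exact: mul0r.
Qed.

Lemma vector_slopes_increment k (f : R -> plane R) f0 T B :
  (forall z e, 0 < e -> \forall y \near F,
     `|dot (f y) z - dot f0 z - d (inl k) y * dot T z - d (inr ord0) y * dot B z|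
     <= e * (`|d (inl k) y| + `|d (inr ord0) y|)) ->
  vector_slopes F d f f0 (increment_coef k T B).
Proof.
move=> h.
have H z : has_slopes F d (fun y => dot (f y) z) (dot f0 z)
    (fun i => dot (increment_coef k T B i) z).
  apply: slopes_of_expansion => e e0; apply: filterS (h z e e0) => y hy.
  rewrite !big_sumType !big_ord1 /=.
  have -> : \sum_l dot ((l == k)%:R *: T) z * d (inl l) y = d (inl k) y * dot T z.
    rewrite -(sum_delta (fun l => d (inl l) y * dot T z)); apply: eq_bigr => l _.
    by rewrite dotZl; ring.
  rewrite [X in `|X|](_ : _ = dot (f y) z - dot f0 z - d (inl k) y * dot T z
    - d (inr ord0) y * dot B z); last by ring.
  apply: (le_trans hy).
  rewrite ler_pM2l // lerD2r (bigD1 k) //= lerDl; exact: sumr_ge0.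
split; [have := H (1, 0)|have := H (0, 1)]; rewrite /dot /=; congr has_slopes;
  try (by apply/funext => y; rewrite mulr1 mulr0 ?addr0 ?add0r);
  by rewrite mulr1 mulr0 ?addr0 ?add0r.
Qed.

End IncrementSlopes.

(** * Derivative of the orbit *)

Section GradientAlgebra.
Context {R : realType}.

(** A row of the Hessian of the length. The curvature contributes k c_j on each of the two flights.
    The weights bj, bp, bs will be Kronecker deltas; for n = 2 those of predecessor and successor
    coincide and their contributions add up. *)
Lemma gradient_param_algebra (vp v tj tp ts t2 : plane R) (cj cp cs k gp gs bj bp bs : R) :
  gp != 0 -> gs != 0 ->
  cross vp tj = - cj -> cross v tj = cj -> cross vp tp = cp -> cross v ts = - cs ->
  dot t2 vp = k * cj -> dot t2 v = - k * cj ->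
  dot (bj *: t2) vp + cross vp tj * cross vp (bj *: tj - bp *: tp) / gp +
  (dot (bj *: t2) (- v) + cross (- v) tj * cross (- v) (bj *: tj - bs *: ts) / gs) =
  bj * (cj * (2 * k + cj / gp + cj / gs)) + bp * (cj * cp / gp) + bs * (cj * cs / gs).
Proof.
move=> gp0 gs0 e1 e2 e3 e4 e5 e6.
rewrite !crossNl !crossBr !crossZr e1 e2 e3 e4 !dotZl (dotC _ (- v)) dotNl (dotC v) e5 e6.
by field; rewrite gp0 gs0.
Qed.

(** The derivative of the gradient in the deformation parameter also has the factor c_j, by the
    reflection law for vp - v; this allows the division by c_j. *)
Lemma gradient_deformation_algebra (vp v tj nj b dp ds : plane R) (cj gp gs : R) :
  gp != 0 -> gs != 0 -> cross vp tj = - cj -> cross v tj = cj ->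
  vp - v = - (2 * cj) *: nj ->
  dot b vp + cross vp tj * cross vp dp / gp +
  (dot b (- v) + cross (- v) tj * cross (- v) ds / gs) =
  cj * (- 2 * dot b nj - cross vp dp / gp + cross v ds / gs).
Proof.
move=> gp0 gs0 e1 e2 e3.
have e4 : dot b vp + dot b (- v) = - 2 * cj * dot b nj.
  by rewrite -dotDr e3 dotZr; ring.
by rewrite !crossNl e1 e2 addrACA e4; field; rewrite gp0 gs0.
Qed.

Lemma divide_cos (c k v p1 p2 s h : R) : c != 0 ->
  c * (2 * k * v + p1 + p2 + s * h) = 0 -> 2 * k * (c * v / c) + p1 + p2 = - s * h.
Proof.
move=> c0 /eqP; rewrite mulf_eq0 (negPf c0) /= => /eqP e.
by apply/eqP; rewrite -subr_eq0; apply/eqP; rewrite -[RHS]e; field.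
Qed.

End GradientAlgebra.

Section OrbitDerivative.
Context {R : realType} {m r r' : nat} (Y : set R) (K : R -> table R m).
Hypotheses (hr : (2 <= r)%N) (hr' : (1 <= r')%N).
Hypothesis hT : forall y, Y y -> billiard_table (K y) r.
Hypothesis iY : is_interval Y.
Context (a : R) {n : nat} (xi : 'I_n -> 'I_m).
Hypotheses (Ya : Y a) (hxi : admissible xi).
Context (D : 'I_n -> nat -> nat -> R -> R -> plane R).
Hypothesis hD : forall k, mixed_partials Y r r' (D k).
Hypothesis hD0 : forall k u y, Y y -> 0 <= u <= perim (K y) (xi k) ->
  param (K y) (xi k) u = D k 0%N 0%N u y.
Context (u : R -> 'I_n -> R).
Hypothesis hu0 : forall k, 0 <= u a k <= perim (K a) (xi k).
Hypothesis hmin : \forall y \near within Y (nbhs a), minimizer (K y) xi (u y).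
Hypothesis hcont : forall k, u y k @[y --> within Y (nbhs a)] --> u a k.
Hypothesis FF : ProperFilter (within Y a^').
Let F := within Y a^'.

Lemma near_within_punctured (A : R -> Prop) :
  (\forall y \near within Y (nbhs a), A y) -> \forall y \near F, A y.
Proof.
move=> h; have h' : \forall y \near a, Y y -> A y by exact: h.
suff : \forall y \near a, y != a -> Y y -> A y by [].
by apply: filterS h' => y hy _.
Qed.

Lemma cvg_within_punctured (f : R -> R) (l : R) :
  f y @[y --> within Y (nbhs a)] --> l -> f y @[y --> F] --> l.
Proof. by move=> h A /h; exact: near_within_punctured. Qed.

Definition increments (i : 'I_n + 'I_1) (y : R) : R :=
  match i with inl k => u y k - u a k | inr _ => y - a end.

Lemma increments_cvg0 i : increments i y @[y --> F] --> (0 : R).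
Proof.
apply: cvg_within_punctured; case: i => [k|_] /=.
  by rewrite -(subrr (u a k)); apply: cvgB; [exact: hcont|exact: cvg_cst].
rewrite -(subrr a); apply: cvgB; last exact: cvg_cst.
by move=> A hA; apply: filterS hA.
Qed.

Lemma near2_orbit k (A : R -> R -> Prop) : near2 Y (u a k) a A ->
  \forall y \near F, A (u y k) y.
Proof.
move=> /near2_ex[d d0 hd]; apply: near_within_punctured.
have h1 : \forall y \near within Y (nbhs a), `|u y k - u a k| < d.
  have /cvgrPdist_lt/(_ d d0) := @hcont k.
  by apply: filterS => y; rewrite distrC.
have h2 : \forall y \near within Y (nbhs a), `|y - a| < d by exact/near1P/near1_ball.
have h3 : \forall y \near within Y (nbhs a), Y y by exact: withinT.
by apply: filterS3 h1 h2 h3 => y; exact: hd.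
Qed.

Lemma vertex_slopes k : vector_slopes F increments
  (fun y => vertex (K y) xi (u y) k) (vertex (K a) xi (u a) k)
  (increment_coef k (tangent (K a) (xi k) (u a k)) (D k 0%N 1%N (u a k) a)).
Proof.
apply: vector_slopes_increment => z e e0.
rewrite (tangentE hr hr' hT (hD k) (@hD0 k) Ya (hu0 k)).
exact: (near2_orbit (param_expansion hr hr' hT (hD k) (@hD0 k) Ya z (hu0 k) e0)).
Qed.

Lemma tangent_slopes k : vector_slopes F increments
  (fun y => tangent (K y) (xi k) (u y k)) (tangent (K a) (xi k) (u a k))
  (increment_coef k (derive1n 2 (param (K a) (xi k)) (u a k))
     (D k 1%N 1%N (u a k) a)).
Proof.
apply: vector_slopes_increment => z e e0.
rewrite (tangent2E_D hr hr' hT (hD k) (@hD0 k) Ya (hu0 k)).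
exact: (near2_orbit (tangent_expansion hr hr' hT iY (hD k) (@hD0 k) Ya z (hu0 k) e0)).
Qed.

Lemma minimizer_at : minimizer (K a) xi (u a).
Proof. by have /nbhs_singleton/(_ Ya) := hmin. Qed.

Notation pt := (vertex (K a) xi (u a)).
Notation vel := (velocity (K a) xi (u a)).
Notation gp := (gap (K a) xi (u a)).
Notation tau j := (tangent (K a) (xi j) (u a j)).
Notation nu j := (normal (K a) (xi j) (u a j)).
Notation kap j := (curvature (K a) (xi j) (u a j)).
Notation D01 j := (D j 0%N 1%N (u a j) a).
Notation D11 j := (D j 1%N 1%N (u a j) a).
Let cosphi j := dot (vel j) (nu j).

(* The derivative of the length function in the j-th parameter. *)
Definition gradient (j : 'I_n) (y : R) : R :=
  dot (tangent (K y) (xi j) (u y j))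
      (direction (vertex (K y) xi (u y) j - vertex (K y) xi (u y) (ord_pred j))) +
  dot (tangent (K y) (xi j) (u y j))
      (direction (vertex (K y) xi (u y) j - vertex (K y) xi (u y) (ordS j))).

Lemma gradient0 j y : Y y -> minimizer (K y) xi (u y) -> gradient j y = 0.
Proof.
move=> Yy hw; rewrite /gradient.
have [h _ _] := specular_orbit hr (hT Yy) hxi hw j.
move: h; rewrite /velocity ord_predK => h.
rewrite -[_ - vertex _ _ _ (ordS j)]opprB directionN (dotC _ (- _)) dotNl.
by rewrite -h dotC subrr.
Qed.

(** Row j of the Hessian of the length for [inl], and the derivative of the gradient in alpha for
    [inr]. *)
Definition gradient_coef (j : 'I_n) (i : 'I_n + 'I_1) : R :=
  let t := increment_coef j (derive1n 2 (param (K a) (xi j)) (u a j)) (D11 j) i in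
  let x k := increment_coef k (tau k) (D01 k) i in
  let ep := direction (pt j - pt (ord_pred j)) in
  let es := direction (pt j - pt (ordS j)) in
  dot t ep + cross ep (tau j) * cross ep (x j - x (ord_pred j)) /
    enorm (pt j - pt (ord_pred j)) +
  (dot t es + cross es (tau j) * cross es (x j - x (ordS j)) /
    enorm (pt j - pt (ordS j))).

Lemma gradient_slopes j : has_slopes F increments (gradient j) 0 (gradient_coef j).
Proof.
rewrite -(gradient0 j Ya minimizer_at).
have ne k : xi k != xi j -> pt j - pt k != 0.
  by move=> h; rewrite subr_eq0; apply: (param_neq (hT Ya)); rewrite eq_sym.
apply: slopesD; apply: slopes_dot_direction.
- exact: increments_cvg0.
- exact/ne/admissible_pred.
- exact: tangent_slopes.
- by apply: (vector_slopesB increments_cvg0); exact: vertex_slopes.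
- exact: increments_cvg0.
- by apply: ne; rewrite eq_sym hxi.
- exact: tangent_slopes.
- by apply: (vector_slopesB increments_cvg0); exact: vertex_slopes.
Qed.

Lemma gradient_coef_sum j (v : 'I_n -> R) s : cosphi j != 0 ->
  \sum_k gradient_coef j (inl k) * v k + gradient_coef j (inr ord0) * s =
  cosphi j * (2 * kap j * v j +
    (cosphi j * v j + cosphi (ord_pred j) * v (ord_pred j)) / gp (ord_pred j) +
    (cosphi j * v j + cosphi (ordS j) * v (ordS j)) / gp j +
    s * (- 2 * dot (D11 j) (nu j)
      - cross (vel (ord_pred j)) (D01 j - D01 (ord_pred j)) / gp (ord_pred j)
      + cross (vel j) (D01 j - D01 (ordS j)) / gp j)).
Proof.
move=> c0.
have crossE k x : cross x (tau k) = dot x (nu k) by rewrite /cross /dot /normal /=; ring.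
have [h1 _ h2] := specular_orbit hr (hT Ya) hxi minimizer_at j.
have [_ _ h3] := specular_orbit hr (hT Ya) hxi minimizer_at (ordS j).
rewrite ordSK in h3.
have epE : direction (pt j - pt (ord_pred j)) = vel (ord_pred j).
  by rewrite /velocity ord_predK.
have esE : direction (pt j - pt (ordS j)) = - vel j by rewrite -opprB directionN.
have npE : enorm (pt j - pt (ord_pred j)) = gp (ord_pred j) by rewrite /gap ord_predK.
have nsE : enorm (pt j - pt (ordS j)) = gp j by rewrite enormB.
have gp0 : gp (ord_pred j) != 0 by rewrite gt_eqF // (gap_gt0 (hT Ya) (u a) hxi).
have gs0 : gp j != 0 by rewrite gt_eqF // (gap_gt0 (hT Ya) (u a) hxi).
have vdiff : vel (ord_pred j) - vel j = - (2 * cosphi j) *: nu j.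
  rewrite [X in _ - X](reflection_law hr (hT Ya) hxi minimizer_at j).
  by rewrite opprB addrC subrK h2 mulrN.
have x1 : cross (vel (ord_pred j)) (tau j) = - cosphi j := etrans (crossE _ _) h2.
have x2 : cross (vel j) (tau j) = cosphi j := crossE _ _.
have x3 : cross (vel (ord_pred j)) (tau (ord_pred j)) = cosphi (ord_pred j) := crossE _ _.
have x4 : cross (vel j) (tau (ordS j)) = - cosphi (ordS j) := etrans (crossE _ _) h3.
have t2E := tangent2E hr (hT Ya) (xi j) (u a j).
have x5 : dot (derive1n 2 (param (K a) (xi j)) (u a j)) (vel (ord_pred j)) = kap j * cosphi j.
  by rewrite t2E dotZl dotC h2 mulrNN.
have x6 : dot (derive1n 2 (param (K a) (xi j)) (u a j)) (vel j) = - kap j * cosphi j.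
  by rewrite t2E dotZl dotC.
clearbody cosphi.
pose A := cosphi j * (2 * kap j + cosphi j / gp (ord_pred j) + cosphi j / gp j).
pose B := cosphi j * cosphi (ord_pred j) / gp (ord_pred j).
pose G := cosphi j * cosphi (ordS j) / gp j.
have Ek k : gradient_coef j (inl k) =
    (k == j)%:R * A + (k == ord_pred j)%:R * B + (k == ordS j)%:R * G.
  rewrite /gradient_coef /increment_coef epE esE npE nsE.
  exact: (gradient_param_algebra _ _ _ gp0 gs0 x1 x2 x3 x4 x5 x6).
have sA : \sum_k (k == j)%:R * (A * v k) = A * v j := sum_delta (fun k => A * v k) j.
have sB : \sum_k (k == ord_pred j)%:R * (B * v k) = B * v (ord_pred j) :=
  sum_delta (fun k => B * v k) (ord_pred j).
have sG : \sum_k (k == ordS j)%:R * (G * v k) = G * v (ordS j) :=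
  sum_delta (fun k => G * v k) (ordS j).
have -> : \sum_k gradient_coef j (inl k) * v k =
    A * v j + B * v (ord_pred j) + G * v (ordS j).
  rewrite -sA -sB -sG -!big_split; apply: eq_bigr => k _ /=; rewrite Ek; ring.
set X := (X in s * X).
have E0 : gradient_coef j (inr ord0) = cosphi j * X.
  rewrite /gradient_coef /increment_coef epE esE npE nsE.
  exact: (gradient_deformation_algebra _ _ _ gp0 gs0 x1 x2 vdiff).
rewrite E0 /A /B /G; move: gp0 gs0.
move: (gp (ord_pred j)) (gp j) (kap j) (cosphi j) (cosphi (ord_pred j))
  (cosphi (ordS j)) (v j) (v (ord_pred j)) (v (ordS j)) X {E0}.
move=> g1 g2 k c1 c2 c3 v1 v2 v3 X g10 g20; field.
by rewrite g10 g20.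
Qed.

Context (C01 C11 : R).
Hypothesis hC01 : forall k, enorm (D01 k) <= C01.
Hypothesis hC11 : forall k, enorm (D11 k) <= C11.
Hypothesis hsingle : forall k, D01 k = 0 \/ D01 (ord_pred k) = 0.

Lemma D01_diff j : enorm (D01 j - D01 (ord_pred j)) <= C01.
Proof. by case: (hsingle j) => ->; rewrite ?sub0r ?subr0 ?enormN. Qed.

(** The weight s of the deformation serves two purposes: s = 0 gives injectivity of the Hessian, s =
    1 the estimate of the derivatives. *)
Lemma linearized_bound (v : 'I_n -> R) s :
  (forall j, \sum_k gradient_coef j (inl k) * v k + gradient_coef j (inr ord0) * s = 0) ->
  forall j, `|v j| <= (cosphi j)^-1 * (`|s| *
    ((C01 + C11 * d_min (K a)) / (kappa_min (K a) * d_min (K a)))).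
Proof.
move=> hv j.
have hw := minimizer_at; have Ta := hT Ya.
have cpos k : 0 < cosphi k by have [_ h _] := specular_orbit hr Ta hxi hw k.
have cle1 k : cosphi k <= 1.
  have := le_trans (ler_norm _) (dot_le (vel k) (nu k)).
  by rewrite (velocity_unit Ta (u a) hxi) (enorm_normal Ta) mulr1.
have dm := d_min_gt0 hr Ta hxi hw j; have km := kappa_min_gt0 hr Ta hxi hw j.
have g0 k := gap_gt0 Ta (u a) hxi k.
have C010 : 0 <= C01 := le_trans (enorm_ge0 _) (hC01 j).
set dmin := d_min (K a) in dm *; set kmin := kappa_min (K a) in km *.
(* C11 is doubled by the factor 2 of the reflection law, C01 / dmin by the two flights. Each flight
   costs C01 only once, because one of its ends belongs to a fixed obstacle. *)
pose B := `|s| * (2 * C11 + 2 * (C01 / dmin)).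
pose H k := - 2 * dot (D11 k) (nu k)
      - cross (vel (ord_pred k)) (D01 k - D01 (ord_pred k)) / gp (ord_pred k)
      + cross (vel k) (D01 k - D01 (ordS k)) / gp k.
have crossb k w : enorm w <= C01 -> `|cross (vel k) w / gp k| <= C01 / dmin.
  move=> hw'; rewrite normrM normfV (gtr0_norm (g0 k)).
  apply: ler_pM => //; first by rewrite invr_ge0 ltW.
    apply: (le_trans (cross_le _ _)); by rewrite (velocity_unit Ta (u a) hxi) mul1r.
  rewrite lef_pV2 ?posrE //; exact: (d_min_le hr Ta hxi hw).
have HB k : `|H k| <= 2 * C11 + 2 * (C01 / dmin).
  have b1 : `|dot (D11 k) (nu k)| <= C11.
    by apply: (le_trans (dot_le _ _)); rewrite (enorm_normal Ta) mulr1.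
  have b2 := crossb (ord_pred k) _ (D01_diff k).
  have b3 : `|cross (vel k) (D01 k - D01 (ordS k)) / gp k| <= C01 / dmin.
    by apply: crossb; rewrite enormB; have := D01_diff (ordS k); rewrite ordSK.
  rewrite /H; move: b1 b2 b3; rewrite !ler_norml.
  by move=> /andP[? ?] /andP[? ?] /andP[? ?]; apply/andP; split; lra.
have eqn k : 2 * kap k * (cosphi k * v k / cosphi k) +
    (cosphi k * v k + cosphi (ord_pred k) * v (ord_pred k)) / gp (ord_pred k) +
    (cosphi k * v k + cosphi (ordS k) * v (ordS k)) / gp k = - s * H k.
  have c0 : cosphi k != 0 by rewrite gt_eqF.
  exact: (divide_cos c0 (etrans (esym (gradient_coef_sum v s c0)) (hv k))).
have EB k : `|- s * H k| <= B.
  by rewrite normrM normrN /B; apply: ler_wpM2l.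
have := maximum_principle km (fun k => kappa_min_le hr Ta hxi hw k)
  (fun k => introT andP (conj (cpos k) (cle1 k))) (fun k => g0 (ord_pred k)) g0 EB eqn j.
rewrite normrM (gtr0_norm (cpos j)) => h.
rewrite -(ler_pM2l (cpos j)); apply: (le_trans h).
rewrite mulrA mulfV ?gt_eqF // mul1r le_eqVlt; apply/orP; left; apply/eqP.
by rewrite /B; field; rewrite !gt_eqF.
Qed.

(** The gradient vanishes along the branch near a, so its slope form is a linear system satisfied
    exactly by the increments, with coefficients tending to [gradient_coef]. *)
Lemma orbit_derivative : exists2 v : 'I_n -> R,
  (forall k, (y - a)^-1 * (u y k - u a k) @[y --> F] --> v k) &
  forall j, `|v j| <= (cosphi j)^-1 *
    ((C01 + C11 * d_min (K a)) / (kappa_min (K a) * d_min (K a))).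
Proof.
have [A hA] := choice gradient_slopes.
have near0 : \forall y \near F, forall j,
    \sum_k A j (inl k) y * (u y k - u a k) + A j (inr ord0) y * (y - a) = 0.
  have h1 : \forall y \near F, forall j,
      gradient j y - 0 = \sum_i A j i y * increments i y.
    by apply: filter_forall => j; exact: (hA j).2.
  have h2 := near_within_punctured hmin.
  have h3 : \forall y \near F, Y y by apply: near_within_punctured; exact: withinT.
  apply: filterS3 h1 h2 h3 => y h1 h2 h3 j.
  by have := h1 j; rewrite gradient0 // subr0 big_sumType big_ord1 /= => <-.
have ne : \forall y \near F, y - a != 0.
  have : \forall y \near a^', y != a by exact: nbhs_dnbhs_neq.
  by apply: filterS => y h _; rewrite subr_eq0.
have [] := @linear_system_limit R F FF n (fun y j k => A j (inl k) y)
  (fun j k => gradient_coef j (inl k)) (fun y j => A j (inr ord0) y)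
  (fun j => gradient_coef j (inr ord0)) (fun k y => u y k - u a k) (fun y => y - a)
  _ _ ne near0.
- by move=> j k; exact: (hA j).1.
- by move=> j; exact: (hA j).1.
- move=> v hv k; apply/eqP; rewrite -normr_le0.
  have := @linearized_bound v 0 _ k; rewrite normr0 mul0r mulr0; apply => j.
  by rewrite mulr0 addr0 hv.
move=> v hv heq; exists v => // j.
have := @linearized_bound v 1 _ j; rewrite normr1 mul1r; apply => k.
by rewrite mulr1 heq.
Qed.

End OrbitDerivative.

(** * The parameter interval, and the theorem *)

Section ParameterInterval.
Context {R : realType} (a b : \bar R) (hab : (a < b)%E).

Lemma param_itv_interval : is_interval (param_itv a b).
Proof.
move=> x y /andP[ax _] /andP[_ yb] z /andP[xz zy]; apply/andP; split.
  by apply: (le_trans ax); rewrite lee_fin.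
by apply: le_trans yb; rewrite lee_fin.
Qed.

(** A nondegenerate interval has no isolated point: step to the right of alpha if alpha < b, to the
    left otherwise. This makes limits within the interval unique. *)
Lemma param_itv_limit_point alpha : param_itv a b alpha ->
  ProperFilter (within (param_itv a b) alpha^').
Proof.
move=> Ya; have [aalpha alphab] := andP Ya.
have H d : 0 < d -> exists y, [/\ `|y - alpha| < d, y != alpha & param_itv a b y].
  move=> d0; have d2 : 0 < d / 2 by rewrite divr_gt0.
  have [lt|ge] := ltP alpha%:E b.
    have [t t0 tb] : exists2 t, 0 < t <= d / 2 & ((alpha + t)%:E <= b)%E.
      case: b lt => [s| |] //; last by move=> _; exists (d / 2); rewrite ?d2 ?lexx ?leey.
      rewrite lte_fin => lt; exists (Num.min (d / 2) (s - alpha)).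
        by rewrite lt_min d2 subr_gt0 lt ge_min lexx.
      by rewrite lee_fin -lerBrDl ge_min lexx orbT.
    have {t0} /andP[t0 td] := t0.
    exists (alpha + t); split.
    - rewrite addrAC subrr add0r gtr0_norm //; lra.
    - by rewrite -subr_eq0 addrAC subrr add0r gt_eqF.
    - by apply/andP; split=> //; apply: (le_trans aalpha); rewrite lee_fin lerDl ltW.
  have lt : (a < alpha%:E)%E by exact: lt_le_trans hab ge.
  have [t t0 tb] : exists2 t, 0 < t <= d / 2 & (a <= (alpha - t)%:E)%E.
    case: a lt => [s| |] //; last by move=> _; exists (d / 2); rewrite ?d2 ?lexx ?leNye.
    rewrite lte_fin => lt; exists (Num.min (d / 2) (alpha - s)).
      by rewrite lt_min d2 subr_gt0 lt ge_min lexx.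
    by rewrite lee_fin lerBrDr -lerBrDl ge_min lexx orbT.
  have {t0} /andP[t0 td] := t0.
  exists (alpha - t); split.
  - by rewrite addrAC subrr add0r normrN gtr0_norm //; lra.
  - by rewrite -subr_eq0 addrAC subrr add0r oppr_eq0 gt_eqF.
  - by apply/andP; split=> //; apply: le_trans alphab; rewrite lee_fin gerBl ltW.
apply: Build_ProperFilter_ex => A hA.
have : \forall y \near alpha, y != alpha -> param_itv a b y -> A y by exact: hA.
move=> /nbhs_ballP[d /= d0 hd]; have [y [y1 y2 y3]] := H d d0.
by exists y; apply: hd => //; rewrite /ball /= distrC.
Qed.

End ParameterInterval.

Theorem theorem3p2 (R : realType) (m r r' : nat) (a b : \bar R)
    (K : R -> table R m) (C : nat -> nat -> R -> R)
    (hm : (3 <= m)%N) (hr : (2 <= r)%N) (hr' : (1 <= r')%N)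
    (hab : (a < b)%E)
    (hK : billiard_deformation (param_itv a b) K r r' C)
    (n : nat) (xi : 'I_n -> 'I_m) (hxi : admissible xi)
    (alpha : R) (halpha : param_itv a b alpha)
    (u : R -> 'I_n -> R) (hu : local_branch (param_itv a b) K xi alpha u)
    (j : 'I_n) :
  exists2 du : R,
    is_derive_within (param_itv a b) (fun y => u y j) alpha du &
    `|du| <= (cos (reflection_angle (K alpha) xi (u alpha) j))^-1 *
      ((C 0%N 1%N alpha + C 1%N 1%N alpha * d_min (K alpha)) /
       (kappa_min (K alpha) * d_min (K alpha))).

Proof.
set Y := param_itv a b in hK halpha hu *.
have hT := deformation_table hK.
have iY : is_interval Y := @param_itv_interval R a b.
have FF : ProperFilter (within Y alpha^') := param_itv_limit_point hab halpha.
have [D hD] := choice (fun k => deformation_smooth hK (xi k)).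
have [hmc hu0] := hu.
have hmin : \forall y \near within Y (nbhs alpha), minimizer (K y) xi (u y).
  by apply: filterS hmc => y [].
have hcont k : u y k @[y --> within Y (nbhs alpha)] --> u alpha k.
  have : \forall y \near alpha, Y y -> minimizer (K y) xi (u y) /\
      (forall k, u z k @[z --> within Y (nbhs y)] --> u y k) by exact: hmc.
  by move=> /nbhs_singleton/(_ halpha)[_]; exact.
have hbound q q' k : (q <= 1)%N -> (q, q') != (0%N, 0%N) -> (q' <= 1)%N ->
    enorm (D k q q' (u alpha k) alpha) <= C q q' alpha.
  move=> hq ne hq'; have [_ _ h] := hD k; apply: h => //.
    exact: (leq_trans hq (leq_trans (isT : (1 <= 2)%N) hr)).
  exact: (leq_trans hq' hr').
have [i0 fixed] := deformation_single hK.
(* The perimeter of a fixed obstacle is constant, so the parameter stays in the strip for every y,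
   where [D] agrees with a constant in y; uniqueness of the limit gives 0. *)
have D01_fixed k : xi k != i0 -> D k 0%N 1%N (u alpha k) alpha = 0.
  move=> ne; have [[_ hw _] h0 _] := hD k.
  have h1 := hw 0%N (u alpha k) alpha hr' halpha.
  apply: (cvg_unique (@norm_hausdorff _ _) h1).
  have h2 : (0 : plane R) @[y --> within Y alpha^'] --> (0 : plane R) by exact: cvg_cst.
  apply: cvg_trans h2; apply: near_eq_cvg.
  have eq0 y : Y y -> 0 =
      (y - alpha)^-1 *: (D k 0%N 0%N (u alpha k) y - D k 0%N 0%N (u alpha k) alpha).
    move=> Yy; have [_ eL eP] := fixed (xi k) ne y alpha Yy halpha.
    by rewrite -h0 ?eL // -h0 // eP subrr scaler0.
  have nY : \forall y \near alpha, y != alpha -> Y y -> Y y by exact: filterE (fun y _ h => h).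
  have {nY} : \forall y \near within Y alpha^', Y y by exact: nY.
  by apply: filterS => y; exact: eq0.
(* Consecutive symbols differ, so at most one of them is the moving obstacle. *)
have single k : D k 0%N 1%N (u alpha k) alpha = 0 \/
    D (ord_pred k) 0%N 1%N (u alpha (ord_pred k)) alpha = 0.
  have [e|ne] := eqVneq (xi k) i0; last by left; exact: D01_fixed.
  by right; apply: D01_fixed; rewrite -e; exact: admissible_pred.
have [v hv bv] := @orbit_derivative R m r r' Y K hr hr' hT iY alpha n xi halpha hxi D
  (fun k => let: And3 h _ _ := hD k in h) (fun k => let: And3 _ h _ := hD k in h)
  u hu0 hmin hcont FF (C 0%N 1%N alpha) (C 1%N 1%N alpha)
  (fun k => hbound 0%N 1%N k isT isT isT) (fun k => hbound 1%N 1%N k isT isT isT) single.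
exists (v j); first exact: hv.
rewrite (cos_reflection_angle (hT _ halpha) _ hxi); exact: bv.
Qed.
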